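(* (i) Suppose $\Gamma_1$ and $\Gamma_2$ are equivalent small categories. Then $\Gamma_1$ is both directly finite and of type ($L^2$) if and only if $\Gamma_2$ is both directly finite and of type ($L^2$). (ii) Let $F\colon\Gamma_1\to\Gamma_2$ be an equivalence of categories, and suppose that $\Gamma_i$ is both directly finite and of type ($L^2$) for $i=1,2$. Then the bijection $U^{(1)}(F)\colon U^{(1)}(\Gamma_1)\xrightarrow{\cong}U^{(1)}(\Gamma_2)$ induced by $F$ sends $\chi^{(2)}_f(\Gamma_1)$ to $\chi^{(2)}_f(\Gamma_2)$, and $$\chi^{(2)}(\Gamma_1)=\chi^{(2)}(\Gamma_2).$$
   Context: A category is directly finite if for all morphisms $u\colon x\to y$, $v\colon y\to x$, $vu=\mathrm{id}_x$ implies $uv=\mathrm{id}_y$. $\mathrm{iso}(\Gamma)$ is the set of isomorphism classes $\overline{x}$ of objects. A $\mathbb{C}\Gamma$-module is a functor $\Gamma^{op}\to\mathbb{C}\text{-Mod}$ (morphisms: natural transformations; exactness objectwise). It is projective iff it is a direct summand of a direct sum of modules of the form $\mathbb{C}\,\mathrm{mor}(?,x)$. $\mathbb{C}[x]:=\mathbb{C}[\mathrm{aut}(x)]$. $S_xM$ is the right $\mathbb{C}[x]$-module obtained as the quotient of $M(x)$ by the submodule generated by the images of all $M(u)\colon M(y)\to M(x)$ with $u\colon x\to y$ not an isomorphism. $\mathcal{N}(G)$ is the group von Neumann algebra of $G$ (bounded operators on $\ell^2(G)$ commuting with the right $G$-action, containing $\mathbb{C}G$), with trace $\mathrm{tr}(f)=\langle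 f(e),e\rangle$; $\mathcal{N}(x):=\mathcal{N}(\mathrm{aut}(x))$. $\dim_{\mathcal{N}(G)}(M)\in[0,\infty]$ is L\''uck's dimension: for a finitely generated projective right module given by an idempotent matrix $(a_{ij})$ it is $\sum_i\mathrm{tr}(a_{ii})$, and for a general right module it is the supremum over finitely generated projective submodules. For an $\mathcal{N}(G)$-chain complex $C_*$, $h^{(2)}(C_* ):=\sum_{p\ge0}\dim_{\mathcal{N}(G)}H_p(C_* )$, and if this is finite, $\chi^{(2)}(C_* ):=\sum_p(-1)^p\dim_{\mathcal{N}(G)}H_p(C_* )$. $\Gamma$ is of type ($L^2$) if for some (equivalently every) projective $\mathbb{C}\Gamma$-resolution $P_*$ (not necessarily finite) of the constant module $\underline{\mathbb{C}}$ one has $\sum_{\overline{x}\in\mathrm{iso}(\Gamma)}h^{(2)}(S_xP_*\otimes_{\mathbb{C}[x]}\mathcal{N}(x))<\infty$. $U^{(1)}(\Gamma)$ is the set of families $(r_{\overline{x}})_{\overline{x}\in\mathrm{iso}(\Gamma)}$ of reals with $\sum|r_{\overline{x}}|<\infty$. For $\Gamma$ of type ($L^2$), $\chi_f^{(2)}(\Gamma):=(\chi^{(2)}(S_xP_*\otimes_{\mathbb{C}[x]}\mathcal{N}(x)))_{\overline{x}}\in U^{(1)}(\Gamma)$ and $\chi^{(2)}(\Gamma)\in\mathbb{R}$ is the sum of its components. $U^{(1)}(F)$ is induced by the bijection $\mathrm{iso}(\Gamma_1)\to\mathrm{iso}(\Gamma_2)$, $\overline{x}\mapsto\overline{F(x)}$.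 *)

(* Defs.v *)
From HB Require Import structures.
From mathcomp Require Import all_boot all_order all_algebra.
From mathcomp Require Import ring_quotient finmap monalg complex.
From mathcomp Require Import all_classical all_reals ereal esum topology.
From mathcomp Require Import normedtype sequences ring lra.

From mathcomp Require summability.

Set Implicit Arguments.
Unset Strict Implicit.
Unset Printing Implicit Defensive.

Import Order.TTheory GRing.Theory Num.Theory numFieldNormedType.Exports.

Local Open Scope classical_set_scope.
Local Open Scope ring_scope.
Local Open Scope quotient_scope.

HB.lock Definition malg_lift (K : choiceType) (A : nzRingType) (V : lmodType A)
    (f : K -> V) (a : {malg A[K]}) : V :=
  \sum_(k <- msupp a) a@_k *: f k.

Section FreeLift.
Variables (K : choiceType) (A : nzRingType) (V : lmodType A).
Implicit Types (a b : {malg A[K]}) (f : K -> V).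

Lemma malg_liftE f a : malg_lift f a = \sum_(k <- msupp a) a@_k *: f k.
Proof. by rewrite malg_lift.unlock. Qed.

Lemma malg_lift_wid f a (D : {fset K}) :
  (msupp a `<=` D)%fset -> malg_lift f a = \sum_(k <- D) a@_k *: f k.
Proof.
move=> sD; rewrite malg_liftE [RHS](big_fsetID _ (mem (msupp a))) /=.
rewrite [X in _ = _ + X]big1_fset ?addr0.
  apply/eq_fbigl => k; rewrite !inE /=.
  by case: (boolP (k \in msupp a)) => [/(fsubsetP sD) ->|]; rewrite ?andbF.
by move=> k; rewrite !inE => /andP[_ /mcoeff_outdom ->] _; rewrite scale0r.
Qed.

Lemma malg_lift_is_linear f : linear (malg_lift f).
Proof.
move=> c a b; set D := (msupp a `|` msupp b)%fset.
have sab : (msupp (c *: a + b) `<=` D)%fset.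
  apply: fsubset_trans (msuppD_le _ _) _.
  by apply: fsetUSS => //; apply: msuppZ_le.
rewrite (malg_lift_wid _ sab) (@malg_lift_wid _ a D) ?fsubsetUl //.
rewrite (@malg_lift_wid _ b D) ?fsubsetUr // scaler_sumr -big_split /=.
by apply: eq_bigr => k _; rewrite mcoeffD mcoeffZ scalerDl scalerA.
Qed.

HB.instance Definition _ f :=
  GRing.isLinear.Build A {malg A[K]} V *:%R (malg_lift f)
    (malg_lift_is_linear f).

Lemma malg_liftU f k : malg_lift f << k >> = f k.
Proof.
by rewrite malg_liftE msuppU oner_eq0 big_seq_fset1 mcoeffUU scale1r.
Qed.

Lemma malg_ind (P : {malg A[K]} -> Prop) :
  (forall a b c, P a -> P b -> P (c *: a + b)) -> P 0 ->
  (forall k, P << k >>) -> forall a, P a.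
Proof.
move=> PD P0 PU a; rewrite (monalgE a); apply: big_ind => //.
  by move=> x y Px Py; rewrite -(scale1r x); apply: PD.
move=> k _; have -> : << a@_k *g k >> = a@_k *: << k >> + 0 :> {malg A[K]}.
  by rewrite addr0; apply/malgP => k'; rewrite mcoeffZ !mcoeffU mulrnAr mulr1.
exact: PD.
Qed.

Lemma malg_lin_ext (f g : {linear {malg A[K]} -> V}) :
  (forall k, f << k >> = g << k >>) -> f =1 g.
Proof.
move=> fg; apply: malg_ind => // [a b c fa fb|]; last by rewrite !linear0.
by rewrite !linearP fa fb.
Qed.

End FreeLift.

Lemma malg_lift_fun (K : choiceType) (A : comNzRingType) (V : lmodType A)
    (c : A) (f g : K -> V) (a : {malg A[K]}) :
  malg_lift (fun k => c *: f k + g k) a =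
  c *: malg_lift f a + malg_lift g a.
Proof.
rewrite !malg_liftE scaler_sumr -big_split /=.
by apply: eq_bigr => k _; rewrite scalerDr !scalerA mulrC.
Qed.

Section Submodules.
Variables (A : pzRingType) (M : lmodType A).

Section Generated.
Variable X : set M.

Definition span_pred : {pred M} := fun m =>
  `[< forall N : submodClosed M, (forall x, X x -> x \in N) -> m \in N >].

Lemma span_submod_closed : submod_closed span_pred.
Proof.
split=> [|c m n /asboolP hm /asboolP hn]; apply/asboolP => N XN.
  exact: rpred0.
by apply: rpredD; [apply: rpredZ; apply: hm|apply: hn].
Qed.

HB.instance Definition _ :=
  GRing.isSubmodClosed.Build A M span_pred span_submod_closed.

Definition span : submodClosed M := span_pred.

Lemma mem_span x : X x -> x \in span.
Proof. by move=> Xx; apply/asboolP => N; apply. Qed.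

Lemma span_sub (N : submodClosed M) m :
  (forall x, X x -> x \in N) -> m \in span -> m \in N.
Proof. by move=> XN /asboolP; apply. Qed.

End Generated.

Section SubType.
Variable N : submodClosed M.

Definition submodule := {m : M | m \in N}.
HB.instance Definition _ := SubChoice.on submodule.
HB.instance Definition _ := [SubChoice_isSubLmodule of submodule by <:].

End SubType.

Section Quotient.
Variable N : submodClosed M.

Fact submod_oppr_closed : oppr_closed N.
Proof. by move=> x Nx; rewrite -scaleN1r rpredZ. Qed.

Definition submod_zmodClosed : zmodClosed M :=
  HB.pack (N : {pred M}) N
    (GRing.isOppClosed.Build M (N : {pred M}) submod_oppr_closed).

Definition quotmod := Quotient.quot submod_zmodClosed.
HB.instance Definition _ := Choice.on quotmod.
HB.instance Definition _ := GRing.Zmodule.on quotmod.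

End Quotient.
End Submodules.

HB.lock Definition quot_proj (A : pzRingType) (M : lmodType A)
    (N : submodClosed M) (m : M) : quotmod N :=
  \pi_(Quotient.quot (submod_zmodClosed N)) m.

HB.lock Definition quot_scale (A : pzRingType) (M : lmodType A)
    (N : submodClosed M) (c : A) (q : quotmod N) : quotmod N :=
  quot_proj N (c *: repr q).

Section QuotientTheory.
Variables (A : pzRingType) (M : lmodType A) (N : submodClosed M).
Local Notation quot_proj := (quot_proj N).
Local Notation quot_scale := (@quot_scale A M N).

Lemma quot_projE m : quot_proj m = \pi_(Quotient.quot (submod_zmodClosed N)) m.
Proof. by rewrite quot_proj.unlock. Qed.

Lemma quot_proj_eq m n : (quot_proj m = quot_proj n) <-> (m - n \in N).
Proof.
rewrite !quot_projE -[m - n \in N]/(m - n \in submod_zmodClosed N) Quotient.idealrBE.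
by split=> [/eqP|/eqP].
Qed.

Lemma quot_proj_repr (q : quotmod N) : quot_proj (repr q) = q.
Proof. by rewrite quot_projE reprK. Qed.

Lemma quot_projD m n : quot_proj (m + n) = quot_proj m + quot_proj n.
Proof. by rewrite !quot_projE Quotient.pi_add. Qed.

Lemma quot_scaleE c m : quot_scale c (quot_proj m) = quot_proj (c *: m).
Proof.
rewrite quot_scale.unlock.
apply/quot_proj_eq; rewrite -scalerBr; apply: rpredZ.
by apply/quot_proj_eq; rewrite quot_proj_repr.
Qed.

Fact quot_scaleA c d q : quot_scale c (quot_scale d q) = quot_scale (c * d) q.
Proof. by rewrite -(quot_proj_repr q) !quot_scaleE scalerA. Qed.

Fact quot_scale1 : left_id 1 quot_scale.
Proof. by move=> q; rewrite -(quot_proj_repr q) quot_scaleE scale1r. Qed.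

Fact quot_scaleDr : right_distributive quot_scale +%R.
Proof.
move=> c p q; rewrite -(quot_proj_repr p) -(quot_proj_repr q).
by rewrite -quot_projD !quot_scaleE -quot_projD scalerDr.
Qed.

Fact quot_scaleDl q : {morph quot_scale^~ q : c d / c + d}.
Proof.
move=> c d; rewrite -(quot_proj_repr q) !quot_scaleE -quot_projD.
by rewrite scalerDl.
Qed.

HB.instance Definition _ := GRing.Zmodule_isLmodule.Build A (quotmod N)
  quot_scaleA quot_scale1 quot_scaleDr quot_scaleDl.

Fact quot_proj_is_linear : linear quot_proj.
Proof. by move=> c m n; rewrite quot_projD -quot_scaleE. Qed.

HB.instance Definition _ :=
  GRing.isLinear.Build A M (quotmod N) *:%R quot_proj quot_proj_is_linear.

End QuotientTheory.

HB.lock Definition quot_map (A : pzRingType) (M M' : lmodType A)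
    (N : submodClosed M) (N' : submodClosed M') (f : {linear M -> M'})
    (fN : forall m, m \in N -> f m \in N') (q : quotmod N) : quotmod N' :=
  quot_proj N' (f (repr q)).

Section QuotientMap.
Variables (A : pzRingType) (M M' : lmodType A).
Variables (N : submodClosed M) (N' : submodClosed M').
Variable f : {linear M -> M'}.
Hypothesis fN : forall m, m \in N -> f m \in N'.

Lemma quot_mapE m : quot_map fN (quot_proj N m) = quot_proj N' (f m).
Proof.
rewrite quot_map.unlock.
apply/quot_proj_eq; rewrite -linearB; apply: fN.
by apply/quot_proj_eq; rewrite quot_proj_repr.
Qed.

Fact quot_map_is_linear : linear (quot_map fN).
Proof.
move=> c p q; rewrite -(quot_proj_repr p) -(quot_proj_repr q).
by rewrite -linearP !quot_mapE !linearP.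
Qed.

HB.instance Definition _ := GRing.isLinear.Build A (quotmod N) (quotmod N')
  *:%R (quot_map fN) quot_map_is_linear.

End QuotientMap.

Lemma span_map (A : pzRingType) (M M' : lmodType A) (X : set M) (X' : set M')
    (f : {linear M -> M'}) :
  (forall x, X x -> f x \in span X') ->
  forall m, m \in span X -> f m \in span X'.
Proof.
move=> fX m /asboolP mX.
pose P : {pred M} := fun m => f m \in span X'.
have PE x : (x \in P) = (f x \in span X') by [].
have PS : submod_closed P.
  split=> [|c x y]; rewrite !PE ?linear0 ?rpred0 // linearP => hx hy.
  by apply: rpredD => //; apply: rpredZ.
pose B := GRing.isSubmodClosed.Build A M P PS.
pose N : submodClosed M := HB.pack P B.
exact: (mX N fX).
Qed.

Record chain_complex (A : pzRingType) := ChainComplex {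
  cpx_ob :> nat -> lmodType A;
  cpx_d : forall n, {linear cpx_ob n.+1 -> cpx_ob n};
  cpx_dd : forall n x, cpx_d n (cpx_d n.+1 x) = 0
}.

Section Homology.
Variables (A : pzRingType) (C : chain_complex A).

Definition cycle_pred n : {pred C n} :=
  match n return C n -> bool with
  | 0 => fun=> true
  | m.+1 => fun x => cpx_d C m x == 0
  end.

Fact cycle_submod_closed n : submod_closed (@cycle_pred n).
Proof.
case: n => [|n]; first by split.
split=> [|c x y]; rewrite !unfold_in ?linear0 // => /eqP hx /eqP hy.
by rewrite linearP hx hy scaler0 addr0.
Qed.

HB.instance Definition _ n := GRing.isSubmodClosed.Build A (C n)
  (@cycle_pred n) (@cycle_submod_closed n).

Definition cycles n : submodClosed (C n) := @cycle_pred n.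

Definition boundary_pred n : {pred submodule (cycles n)} :=
  fun z => `[< exists y, cpx_d C n y = val z >].

Fact boundary_submod_closed n : submod_closed (@boundary_pred n).
Proof.
split=> [|c x y /asboolP[x' hx] /asboolP[y' hy]]; apply/asboolP.
  by exists 0; rewrite !linear0.
by exists (c *: x' + y'); rewrite !linearP hx hy.
Qed.

HB.instance Definition _ n := GRing.isSubmodClosed.Build A
  (submodule (cycles n)) (@boundary_pred n) (@boundary_submod_closed n).

Definition boundaries n : submodClosed (submodule (cycles n)) :=
  @boundary_pred n.

Definition homology n : lmodType A := quotmod (boundaries n).

End Homology.

(* Right A-modules are lmodType A^c: [a *: m] in an A^c-module is m.a, and    *)
(* [m.a.b] is [b *: (a *: m)] = [((a : A) * b) *: m].                         *)
Section TensorDef.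
Variables (A B : pzRingType) (phi : {rmorphism A -> B}) (M : lmodType A^c).

Let F := {malg int[(M * B)%type]}.

Let bas (m : M) (b : B) : F := << (m, b) >>.

Definition tensor_rel : set F :=
  [set z | exists m m' b, z = bas (m + m') b - bas m b - bas m' b] `|`
  [set z | exists m b b', z = bas m (b + b') - bas m b - bas m b'] `|`
  [set z | exists m (a : A) b, z = bas ((a : A^c) *: m) b - bas m (phi a * b)].

(* The balanced tensor product M (x)_A B, where B is a left A-module by phi.  *)
Definition tensor := quotmod (span tensor_rel).
HB.instance Definition _ := Choice.on tensor.
HB.instance Definition _ := GRing.Zmodule.on tensor.

Let act_basis (b' : B) (k : M * B) : F := bas k.1 (k.2 * b').

Fact act_rel b' z : z \in span tensor_rel ->
  malg_lift (act_basis b') z \in span tensor_rel.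
Proof.
apply: span_map => {}z [[|]|].
- move=> [m [m' [b ->]]]; rewrite !linearB /= !malg_liftU; apply: mem_span.
  by left; left; exists m, m', (b * b').
- move=> [m [b [b'' ->]]]; rewrite !linearB /= !malg_liftU; apply: mem_span.
  by left; right; exists m, (b * b'), (b'' * b'); rewrite /act_basis /= mulrDl.
move=> [m [a [b ->]]]; rewrite !linearB /= !malg_liftU; apply: mem_span.
by right; exists m, a, (b * b'); rewrite /act_basis /= mulrA.
Qed.

End TensorDef.

HB.lock Definition tens (A B : pzRingType) (phi : {rmorphism A -> B})
    (M : lmodType A^c) (m : M) (b : B) : tensor phi M :=
  quot_proj (span (tensor_rel phi (M := M))) << (m, b) >>.

HB.lock Definition tensor_act (A B : pzRingType) (phi : {rmorphism A -> B})
    (M : lmodType A^c) (b : B^c) (t : tensor phi M) : tensor phi M :=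
  quot_map (@act_rel A B phi M b) t.

Section Tensor.
Variables (A B : pzRingType) (phi : {rmorphism A -> B}) (M : lmodType A^c).
Local Notation tensor := (tensor phi M).
Local Notation tens := (@tens A B phi M).
Local Notation tensor_act := (@tensor_act A B phi M).

Lemma tens_ind (P : tensor -> Prop) :
  P 0 -> (forall s t, P s -> P t -> P (s + t)) -> (forall t, P t -> P (- t)) ->
  (forall m b, P (tens m b)) -> forall t, P t.
Proof.
move=> P0 PD PN Pt t; rewrite -(quot_proj_repr t).
have Pn (n : nat) u : P u -> P (u *+ n).
  by move=> Pu; elim: n => [//|n IH]; rewrite mulrS; apply: PD.
elim/malg_ind: (repr t) => [a b c Pa Pb||[m b]]; first 2 last.
- by move: (Pt m b); rewrite tens.unlock.
- rewrite linearP /=; apply: PD => //.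
  case: c => n; first by rewrite -natz scaler_nat; apply: Pn.
  by rewrite NegzE scaleNr -natz scaler_nat; apply/PN/Pn.
by rewrite linear0.
Qed.

Lemma tensDl m m' b : tens (m + m') b = tens m b + tens m' b.
Proof.
rewrite tens.unlock.
apply/eqP; rewrite -subr_eq0 opprD addrA -!linearB -(linear0 (quot_proj _)).
apply/eqP/quot_proj_eq; rewrite subr0; apply: mem_span.
by left; left; exists m, m', b.
Qed.

Lemma tensDr m b b' : tens m (b + b') = tens m b + tens m b'.
Proof.
rewrite tens.unlock.
apply/eqP; rewrite -subr_eq0 opprD addrA -!linearB -(linear0 (quot_proj _)).
apply/eqP/quot_proj_eq; rewrite subr0; apply: mem_span.
by left; right; exists m, b, b'.
Qed.

Lemma tensMA m (a : A) b : tens ((a : A^c) *: m) b = tens m (phi a * b).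
Proof.
rewrite tens.unlock; apply/quot_proj_eq/mem_span.
by right; exists m, a, b.
Qed.

Lemma tens0 b : tens 0 b = 0.
Proof. by apply: (addrI (tens 0 b)); rewrite -tensDl !addr0. Qed.

Lemma tensor_actE (b' : B) m b : tensor_act b' (tens m b) = tens m (b * b').
Proof. by rewrite tensor_act.unlock tens.unlock quot_mapE /= malg_liftU. Qed.

Fact tensor_actDr : right_distributive tensor_act +%R.
Proof. by move=> b s t; rewrite tensor_act.unlock; apply: linearD. Qed.

Lemma tensor_actN b t : tensor_act b (- t) = - tensor_act b t.
Proof. rewrite tensor_act.unlock; exact: linearN. Qed.

Lemma tensor_act0 b : tensor_act b 0 = 0.
Proof. rewrite tensor_act.unlock; exact: linear0. Qed.

Fact tensor_actA b c t : tensor_act b (tensor_act c t) = tensor_act (b * c) t.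
Proof.
elim/tens_ind: t => [|s t hs ht|t ht|m d]; rewrite ?tensor_act0 //.
- by rewrite !tensor_actDr hs ht.
- by rewrite !tensor_actN ht.
by rewrite !tensor_actE -mulrA.
Qed.

Fact tensor_act1 : left_id 1 tensor_act.
Proof.
elim/tens_ind => [|s t hs ht|t ht|m d]; rewrite ?tensor_act0 //.
- by rewrite tensor_actDr hs ht.
- by rewrite tensor_actN ht.
by rewrite tensor_actE mulr1.
Qed.

Fact tensor_actDl t : {morph tensor_act^~ t : b c / b + c}.
Proof.
move=> b c; elim/tens_ind: t => [|s t hs ht|t ht|m d].
- by rewrite !tensor_act0 addr0.
- by rewrite !tensor_actDr hs ht addrACA.
- by rewrite !tensor_actN ht opprD.
by rewrite !tensor_actE mulrDr tensDr.
Qed.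

HB.instance Definition _ := GRing.Zmodule_isLmodule.Build B^c tensor
  tensor_actA tensor_act1 tensor_actDr tensor_actDl.

End Tensor.

Section TensorMapRel.
Variables (A B : pzRingType) (phi : {rmorphism A -> B}).
Variables (M M' : lmodType A^c) (f : {linear M -> M'}).

Let map_basis (k : M * B) : {malg int[(M' * B)%type]} := << (f k.1, k.2) >>.

Fact tensor_map_rel z : z \in span (tensor_rel phi (M := M)) ->
  malg_lift map_basis z \in span (tensor_rel phi (M := M')).
Proof.
apply: span_map => {}z [[|]|].
- move=> [m [m' [b ->]]]; rewrite !linearB /= !malg_liftU; apply: mem_span.
  by left; left; exists (f m), (f m'), b; rewrite /map_basis /= linearD.
- move=> [m [b [b' ->]]]; rewrite !linearB /= !malg_liftU; apply: mem_span.
  by left; right; exists (f m), b, b'.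
move=> [m [a [b ->]]]; rewrite !linearB /= !malg_liftU; apply: mem_span.
by right; exists (f m), a, b; rewrite /map_basis /= linearZ.
Qed.

End TensorMapRel.

HB.lock Definition tensor_map (A B : pzRingType) (phi : {rmorphism A -> B})
    (M M' : lmodType A^c) (f : {linear M -> M'}) (t : tensor phi M) :
    tensor phi M' :=
  quot_map (@tensor_map_rel A B phi M M' f) t.

Section TensorMap.
Variables (A B : pzRingType) (phi : {rmorphism A -> B}).
Variables (M M' : lmodType A^c) (f : {linear M -> M'}).
Local Notation tensor_map := (@tensor_map A B phi M M' f).

Lemma tensor_mapE m b : tensor_map (tens phi m b) = tens phi (f m) b.
Proof. by rewrite tensor_map.unlock tens.unlock quot_mapE /= malg_liftU. Qed.

Lemma tensor_mapD s t : tensor_map (s + t) = tensor_map s + tensor_map t.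
Proof. rewrite tensor_map.unlock; exact: linearD. Qed.

Lemma tensor_mapN t : tensor_map (- t) = - tensor_map t.
Proof. rewrite tensor_map.unlock; exact: linearN. Qed.

Lemma tensor_map0 : tensor_map 0 = 0.
Proof. rewrite tensor_map.unlock; exact: linear0. Qed.

Fact tensor_map_is_linear : linear tensor_map.
Proof.
move=> b s t; rewrite tensor_mapD; congr (_ + _).
elim/tens_ind: s => [|s s' hs hs'|s hs|m d].
- by rewrite scaler0 tensor_map0 scaler0.
- by rewrite scalerDr !tensor_mapD hs hs' scalerDr.
- by rewrite scalerN !tensor_mapN hs scalerN.
by rewrite [b *: _]tensor_actE !tensor_mapE [b *: _]tensor_actE.
Qed.

HB.instance Definition _ := GRing.isLinear.Build B^c (tensor phi M)
  (tensor phi M') *:%R tensor_map tensor_map_is_linear.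

End TensorMap.

Section TensorComplex.
Variables (A B : pzRingType) (phi : {rmorphism A -> B}).
Variable C : chain_complex A^c.

Definition tensor_cpx_d n : {linear tensor phi (C n.+1) -> tensor phi (C n)} :=
  @tensor_map _ _ phi _ _ (cpx_d C n).

Fact tensor_cpx_dd n t : tensor_cpx_d n (tensor_cpx_d n.+1 t) = 0.
Proof.
elim/tens_ind: t => [|s s' hs hs'|s hs|m d]; rewrite ?linear0 //.
- by rewrite !linearD hs hs' addr0.
- by rewrite !linearN hs oppr0.
by rewrite /tensor_cpx_d /= !tensor_mapE cpx_dd tens0.
Qed.

Definition tensor_cpx : chain_complex B^c := ChainComplex tensor_cpx_dd.

End TensorComplex.

Definition group_algebra (K : comNzRingType) (G : groupType) := {malg K[G]}.

Section GroupAlgebra.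
Variables (K : comNzRingType) (G : groupType).
Local Notation KG := (group_algebra K G).

HB.instance Definition _ := Choice.on KG.
HB.instance Definition _ := GRing.Zmodule.on KG.
HB.instance Definition _ := GRing.Lmodule.on KG.

Definition ga_elt (g : G) : KG := << g >>.

Definition ga_mul (a b : KG) : KG :=
  malg_lift (fun g => malg_lift (fun h => ga_elt (g * h)%g) b) a.

Lemma ga_ind (P : KG -> Prop) :
  (forall a b c, P a -> P b -> P (c *: a + b)) -> P 0 ->
  (forall g, P (ga_elt g)) -> forall a, P a.
Proof. exact: malg_ind. Qed.

Lemma ga_mulU g h : ga_mul (ga_elt g) (ga_elt h) = ga_elt (g * h)%g.
Proof. by rewrite /ga_mul !malg_liftU. Qed.

Lemma ga_mulPl c a a' b : ga_mul (c *: a + a') b = c *: ga_mul a b + ga_mul a' b.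
Proof. by rewrite /ga_mul linearP. Qed.

Lemma ga_mulPr c a b b' : ga_mul a (c *: b + b') = c *: ga_mul a b + ga_mul a b'.
Proof.
rewrite /ga_mul -malg_lift_fun; congr malg_lift; apply/funext => g.
by rewrite linearP.
Qed.

Lemma ga_mul0l b : ga_mul 0 b = 0. Proof. exact: linear0. Qed.

Lemma ga_mul0r a : ga_mul a 0 = 0.
Proof.
have := ga_mulPr 1 a 0 0; rewrite !scale1r addr0 => /eqP.
by rewrite -subr_eq0 opprD addrA subrr sub0r oppr_eq0 => /eqP.
Qed.

Fact ga_mulA : associative ga_mul.
Proof.
move=> a b c; elim/ga_ind: a => [a a' k ha ha'||g].
- by rewrite !ga_mulPl ha ha'.
- by rewrite !ga_mul0l.
elim/ga_ind: b => [b b' k hb hb'||h].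
- by rewrite ga_mulPl !ga_mulPr ga_mulPl hb hb'.
- by rewrite ga_mul0l !ga_mul0r ga_mul0l.
elim/ga_ind: c => [c c' k hc hc'||k].
- by rewrite !ga_mulPr hc hc'.
- by rewrite !ga_mul0r.
by rewrite !ga_mulU mulgA.
Qed.

Fact ga_mul1l : left_id (ga_elt 1%g) ga_mul.
Proof.
elim/ga_ind => [b b' k hb hb'||h].
- by rewrite ga_mulPr hb hb'.
- by rewrite ga_mul0r.
by rewrite ga_mulU mul1g.
Qed.

Fact ga_mul1r : right_id (ga_elt 1%g) ga_mul.
Proof.
elim/ga_ind => [b b' k hb hb'||h].
- by rewrite ga_mulPl hb hb'.
- by rewrite ga_mul0l.
by rewrite ga_mulU mulg1.
Qed.

Fact ga_mulDl : left_distributive ga_mul +%R.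
Proof. by move=> a b c; rewrite -[a]scale1r ga_mulPl !scale1r. Qed.

Fact ga_mulDr : right_distributive ga_mul +%R.
Proof. by move=> a b c; rewrite -[b]scale1r ga_mulPr !scale1r. Qed.

HB.instance Definition _ := GRing.Zmodule_isPzRing.Build KG
  ga_mulA ga_mul1l ga_mul1r ga_mulDl ga_mulDr.

End GroupAlgebra.

Section L2.
Variables (R : realType) (G : groupType).
Local Notation C := R[i].

Definition sqnorm (f : G -> C) : \bar R :=
  \esum_(g in [set: G]) ((Normc.normc (f g)) ^+ 2)%:E.

Definition l2_pred : {pred G -> C} := fun f => `[< (sqnorm f < +oo)%E >].

Lemma sqnorm_ge0 f : (0 <= sqnorm f)%E.
Proof. by apply: esum_ge0 => g _; rewrite lee_fin sqr_ge0. Qed.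

Lemma normc_ge0 (z : C) : 0 <= Normc.normc z.
Proof. by case: z => x y; rewrite sqrtr_ge0. Qed.

Lemma sqr_normcD (z w : C) : (Normc.normc (z + w)) ^+ 2 <=
  (Normc.normc z ^+ 2 + Normc.normc z ^+ 2) +
  (Normc.normc w ^+ 2 + Normc.normc w ^+ 2).
Proof.
case: z w => [a b] [c d] /=; rewrite !sqr_sqrtr ?addr_ge0 ?sqr_ge0 //.
by have := sqr_ge0 (a - c); have := sqr_ge0 (b - d); nra.
Qed.

Lemma sqnormD f f' : (sqnorm (f + f')%R <=
  (sqnorm f + sqnorm f) + (sqnorm f' + sqnorm f'))%E.
Proof.
have h0 (h : G -> C) g : (0 <= ((Normc.normc (h g)) ^+ 2)%:E)%E.
  by rewrite lee_fin sqr_ge0.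
have h1 (h : G -> C) g : (0 <= ((Normc.normc (h g)) ^+ 2)%:E +
    ((Normc.normc (h g)) ^+ 2)%:E)%E by rewrite adde_ge0.
rewrite /sqnorm -!esumD //; apply: le_esum => g _.
by rewrite -!EFinD lee_fin; apply: sqr_normcD.
Qed.

Lemma sqnormZ c f : (sqnorm (c *: f)%R <= (Normc.normc c ^+ 2)%R%:E * sqnorm f)%E.
Proof.
apply: ge_ereal_sup => _ [X [finX XT]] <-.
have -> : (\sum_(g \in X) ((Normc.normc ((c *: f)%R g)) ^+ 2)%:E)%E =
    ((Normc.normc c ^+ 2)%R%:E * \sum_(g \in X) ((Normc.normc (f g)) ^+ 2)%:E)%E.
  rewrite ge0_mule_fsumr => [|g]; last by rewrite lee_fin sqr_ge0.
  apply: eq_fsbigr => g _; rewrite -EFinM; congr EFin.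
  by rewrite -exprMn -Normc.normcM.
by rewrite lee_wpmul2l ?lee_fin ?sqr_ge0 //; apply: ereal_sup_ubound; exists X.
Qed.

Lemma sqnorm0 : sqnorm (0 : G -> C) = 0%E.
Proof. apply: esum1 => g _; rewrite -[(0 : G -> C) g]/(0 : C) Normc.normc0.
by rewrite expr0n. Qed.

Fact l2_submod_closed : submod_closed l2_pred.
Proof.
split=> [|c f f' /asboolP hf /asboolP hf']; apply/asboolP.
  by rewrite sqnorm0.
apply: le_lt_trans (sqnormD _ _) _.
have hc : (sqnorm (c *: f)%R < +oo)%E.
  by apply: le_lt_trans (sqnormZ _ _) _; rewrite lte_mul_pinfty ?lee_fin ?sqr_ge0.
by rewrite !lte_add_pinfty.
Qed.

HB.instance Definition _ :=
  GRing.isSubmodClosed.Build C (G -> C) l2_pred l2_submod_closed.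

Definition l2 := {f : G -> C | f \in l2_pred}.
HB.instance Definition _ := SubChoice.on l2.
HB.instance Definition _ := [SubChoice_isSubLmodule of l2 by <:].

Implicit Types u v : l2.

Definition l2norm u : R := Num.sqrt (fine (sqnorm (val u))).

Definition l2dot u v : C :=
  summability.sum (fun g : G => val u g * (val v g)^* : C^o).

Lemma sqnorm_fin u : sqnorm (val u) \is a fin_num.
Proof.
rewrite ge0_fin_numE ?sqnorm_ge0 //.
by have /asboolP := valP u.
Qed.

Lemma l2normD u v : l2norm (u + v) ^+ 2 <=
  2 * l2norm u ^+ 2 + 2 * l2norm v ^+ 2.
Proof.
rewrite !sqr_sqrtr ?fine_ge0 ?sqnorm_ge0 //.
have := sqnormD (val u) (val v).
rewrite -[sqnorm (val u + _)]/(sqnorm (val (u + v))).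
rewrite -(fineK (sqnorm_fin u)) -(fineK (sqnorm_fin v)).
rewrite -(fineK (sqnorm_fin (u + v))) -!EFinD lee_fin /=.
by rewrite !mulr_natl !mulr2n.
Qed.

Lemma l2normZ c u : l2norm (c *: u) ^+ 2 <= Normc.normc c ^+ 2 * l2norm u ^+ 2.
Proof.
rewrite !sqr_sqrtr ?fine_ge0 ?sqnorm_ge0 //.
have := sqnormZ c (val u).
rewrite -[sqnorm (c *: _)]/(sqnorm (val (c *: u))).
rewrite -(fineK (sqnorm_fin u)).
by rewrite -(fineK (sqnorm_fin (c *: u))) -EFinM lee_fin.
Qed.

Lemma l2norm_ge0 u : 0 <= l2norm u. Proof. exact: sqrtr_ge0. Qed.

Lemma l2_bij_closed (s s' : G -> G) u : cancel s s' -> cancel s' s ->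
  val u \o s \in l2_pred /\ sqnorm (val u \o s) = sqnorm (val u).
Proof.
move=> ss' s's; have e : sqnorm (val u \o s) = sqnorm (val u).
  rewrite /sqnorm [RHS](reindex_esum [set: G] [set: G] s) //.
  by split=> [//|x y _ _ /(can_inj ss')//|y _]; exists (s' y).
split=> //; apply/asboolP; rewrite e.
by have /asboolP := valP u.
Qed.

Definition l2_perm (s s' : G -> G) (ss' : cancel s s') (s's : cancel s' s) u :
  l2 := exist _ (val u \o s) (l2_bij_closed u ss' s's).1.

Lemma l2norm_perm s s' (ss' : cancel s s') (s's : cancel s' s) u :
  l2norm (l2_perm ss' s's u) = l2norm u.
Proof. by rewrite /l2norm (l2_bij_closed u ss' s's).2. Qed.

(* (u.g)(h) = u (h g^-1) and (g.u)(h) = u (g^-1 h), i.e. e_h.g = e_(hg) and   *)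
(* g.e_h = e_(gh) on the canonical basis.                                     *)
Definition l2_ract (g : G) : l2 -> l2 := l2_perm (mulgVK g) (mulgK g).
Definition l2_lact (g : G) : l2 -> l2 := l2_perm (mulVKg g) (mulKg g).

Fact l2_delta_subproof (g : G) : (fun h => (h == g)%:R : C) \in l2_pred.
Proof.
apply/asboolP; rewrite /sqnorm.
rewrite (eq_esum (b := fun h => if h \in [set g] then 1%E else 0%E)).
  by rewrite -esum_mkcond esum_set1 // ltry.
move=> h _; case: (eqVneq h g) => [->|hg].
  by rewrite Normc.normc1 expr1n mem_set.
by rewrite Normc.normc0 expr0n memNset // => /eqP; rewrite (negbTE hg).
Qed.
Definition l2_delta g : l2 :=
  exist (fun f => f \in l2_pred) _ (l2_delta_subproof g).
End L2.


Section GroupVonNeumann.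
Variables (R : realType) (G : groupType).
Local Notation C := R[i].
Local Notation l2G := (l2 R G).
Implicit Types (S T : l2G -> l2G) (u v : l2G).

Definition bounded_op T : Prop :=
  exists K : R, forall u, l2norm (T u) <= K * l2norm u.

Definition vN_pred : {pred l2G -> l2G} := fun T =>
  `[< [/\ linear T, bounded_op T &
          forall g u, T (l2_ract g u) = l2_ract g (T u)] >].

Lemma bounded_opP T : bounded_op T <->
  exists2 K : R, 0 <= K & forall u, l2norm (T u) ^+ 2 <= K * l2norm u ^+ 2.
Proof.
split=> [[K hK]|[K K0 hK]].
  exists (K ^+ 2) => [|u]; first exact: sqr_ge0.
  by rewrite -exprMn lerXn2r ?nnegrE ?l2norm_ge0 // (le_trans (l2norm_ge0 (T u))).
exists (Num.sqrt K) => u.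
have h0 : 0 <= Num.sqrt K * l2norm u by rewrite mulr_ge0 ?sqrtr_ge0 ?l2norm_ge0.
have := hK u; rewrite -{1}(sqr_sqrtr K0) -exprMn.
by rewrite ler_pXn2r // nnegrE ?l2norm_ge0.
Qed.

Lemma l2_ractP g c u v : l2_ract g (c *: u + v) = c *: l2_ract g u + l2_ract g v.
Proof. exact: val_inj. Qed.

Lemma l2_lactP g c u v : l2_lact g (c *: u + v) = c *: l2_lact g u + l2_lact g v.
Proof. exact: val_inj. Qed.

Fact vN_submod_closed : submod_closed vN_pred.
Proof.
split=> [|c S T /asboolP[lS bS cS] /asboolP[lT bT cT]]; apply/asboolP; split.
- by move=> c u v; rewrite scaler0 addr0.
- exists 0 => u; rewrite mul0r.
  have -> : (0 : l2G -> l2G) u = 0 *: u by rewrite scale0r.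
  have := l2normZ 0 u; rewrite Normc.normc0 expr0n mul0r => h.
  by move: h; rewrite exprn_even_le0 //= => /eqP ->; rewrite lexx.
- by move=> g u; apply: val_inj.
- move=> d u v /=.
  rewrite -[LHS]/(c *: S (d *: u + v) + T (d *: u + v)).
  rewrite -[RHS]/(d *: (c *: S u + T u) + (c *: S v + T v)).
  rewrite lS lT !scalerDr !scalerA [c * d]mulrC -!addrA; congr (_ + _).
  by rewrite addrCA.
- move/bounded_opP: bS => [K K0 hK]; move/bounded_opP: bT => [L L0 hL].
  apply/bounded_opP.
  exists (2 * (Normc.normc c ^+ 2 * K) + 2 * L) => [|u].
    by apply: addr_ge0; do ?[exact: sqr_ge0 | exact: ler0n | exact: K0
      | exact: L0 | apply: mulr_ge0].
  apply: le_trans (l2normD (c *: S u) (T u)) _.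
  rewrite [leRHS]mulrDl; apply: lerD; rewrite -[leRHS]mulrA ler_wpM2l ?ler0n //.
  apply: le_trans (l2normZ _ _) _.
  by rewrite -[leRHS]mulrA ler_wpM2l ?sqr_ge0.
move=> g u; rewrite -[LHS]/(c *: S (l2_ract g u) + T (l2_ract g u)).
by rewrite cS cT -l2_ractP.
Qed.

HB.instance Definition _ :=
  GRing.isSubmodClosed.Build C (l2G -> l2G) vN_pred vN_submod_closed.

Definition vN := {T : l2G -> l2G | T \in vN_pred}.
HB.instance Definition _ := SubChoice.on vN.
HB.instance Definition _ := [SubChoice_isSubLmodule of vN by <:].

Lemma vN_linear (T : vN) : linear (val T).
Proof. by have /asboolP[] := valP T. Qed.

Fact vN_mul_subproof (S T : vN) : val S \o val T \in vN_pred.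
Proof.
have /asboolP[lS [K hK] cS] := valP S; have /asboolP[lT [L hL] cT] := valP T.
apply/asboolP; split.
- by move=> c u v /=; rewrite lT lS.
- exists (`|K| * L) => u /=; apply: le_trans (hK _) _.
  rewrite -mulrA; apply: le_trans (ler_wpM2l _ (hL u)); rewrite ?normr_ge0 //.
  by rewrite ler_wpM2r ?l2norm_ge0 ?ler_norm.
by move=> g u /=; rewrite cT cS.
Qed.

Definition vN_mul (S T : vN) : vN :=
  exist (fun T => T \in vN_pred) _ (vN_mul_subproof S T).

Fact vN_one_subproof : id \in vN_pred.
Proof.
by apply/asboolP; split=> [//||//]; exists 1 => u; rewrite mul1r.
Qed.

Definition vN_one : vN := exist (fun T => T \in vN_pred) _ vN_one_subproof.

Fact vN_mulA : associative vN_mul.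
Proof. by move=> S T U; apply: val_inj. Qed.

Fact vN_mul1l : left_id vN_one vN_mul.
Proof. by move=> T; apply: val_inj. Qed.

Fact vN_mul1r : right_id vN_one vN_mul.
Proof. by move=> T; apply: val_inj. Qed.

Fact vN_mulDl : left_distributive vN_mul +%R.
Proof. by move=> S T U; apply: val_inj. Qed.

Fact vN_mulDr : right_distributive vN_mul +%R.
Proof.
move=> S T U; apply: val_inj; apply/funext => u /=.
have := vN_linear S 1 (val T u) (val U u); rewrite !scale1r; apply.
Qed.

HB.instance Definition _ := GRing.Zmodule_isPzRing.Build vN
  vN_mulA vN_mul1l vN_mul1r vN_mulDl vN_mulDr.

Definition vN_tr (T : vN) : C :=
  l2dot (val T (l2_delta R 1%g)) (l2_delta R 1%g).

Fact vN_lreg_subproof (g : G) : @l2_lact R G g \in vN_pred.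
Proof.
apply/asboolP; split.
- by move=> c u v; rewrite l2_lactP.
- by exists 1 => u; rewrite mul1r l2norm_perm.
by move=> h u; apply: val_inj; apply/funext => k /=; rewrite mulgA.
Qed.

Definition vN_lreg (g : G) : vN :=
  exist (fun T => T \in vN_pred) _ (vN_lreg_subproof g).

Definition ga_vN (a : group_algebra C G) : vN := malg_lift vN_lreg a.

Fact ga_vN_is_additive : zmod_morphism ga_vN.
Proof. by move=> a b; rewrite /ga_vN linearB. Qed.

Lemma ga_vNP c a b : ga_vN (c *: a + b) = c *: ga_vN a + ga_vN b.
Proof. by rewrite /ga_vN linearP. Qed.

Lemma ga_vN_elt g : ga_vN (ga_elt C g) = vN_lreg g.
Proof. by rewrite /ga_vN malg_liftU. Qed.

Fact ga_vN_is_multiplicative : monoid_morphism ga_vN.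
Proof.
split.
  rewrite -[1]/(ga_elt C 1%g) ga_vN_elt; apply: val_inj; apply/funext => u.
  by apply: val_inj; apply/funext => h /=; rewrite invg1 mul1g.
move=> a b; rewrite -[a * b]/(ga_mul a b).
elim/ga_ind: a => [a a' k ha ha'||g].
- rewrite ga_mulPl !ga_vNP ha ha' mulrDl; congr (_ + _).
  by apply: val_inj.
- by rewrite ga_mul0l /ga_vN linear0 mul0r.
elim/ga_ind: b => [b b' k hb hb'||h].
- rewrite ga_mulPr !ga_vNP hb hb' mulrDr; congr (_ + _).
  apply: val_inj; apply/funext => u /=.
  have := vN_linear (ga_vN (ga_elt C g)) k (val (ga_vN b) u) 0.
  have h0 (T : vN) : val T 0 = 0.
    by have := vN_linear T (-1) 0 0; rewrite scaleN1r oppr0 addr0 scaleN1r addNr.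
  by rewrite h0 !addr0.
- by rewrite ga_mul0r /ga_vN linear0 mulr0.
rewrite ga_mulU !ga_vN_elt; apply: val_inj; apply/funext => u.
by apply: val_inj; apply/funext => k /=; rewrite invgM mulgA.
Qed.

HB.instance Definition _ :=
  GRing.isZmodMorphism.Build (group_algebra C G) vN ga_vN ga_vN_is_additive.
HB.instance Definition _ :=
  GRing.isMonoidMorphism.Build (group_algebra C G) vN ga_vN
    ga_vN_is_multiplicative.

End GroupVonNeumann.

Record category := Category {
  ob :> Type;
  hom : ob -> ob -> Type;
  idm : forall x, hom x x;
  compm : forall x y z, hom y z -> hom x y -> hom x z;
  compmA : forall x y z t (w : hom z t) (v : hom y z) (u : hom x y),
    compm w (compm v u) = compm (compm w v) u;
  comp1m : forall x y (u : hom x y), compm (idm y) u = u;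
  compm1 : forall x y (u : hom x y), compm u (idm x) = u
}.

Section Categories.
Variable Gam : category.
Implicit Types x y z : Gam.

Definition is_iso x y (u : hom x y) : Prop :=
  exists v : hom y x, compm v u = idm x /\ compm u v = idm y.

Definition directly_finite : Prop :=
  forall x y (u : hom x y) (v : hom y x),
    compm v u = idm x -> compm u v = idm y.

Definition isomorphic x y : Prop := exists u : hom x y, is_iso u.

Lemma is_iso_id x : is_iso (idm x).
Proof. by exists (idm x); rewrite comp1m. Qed.

Lemma is_iso_comp x y z (v : hom y z) (u : hom x y) :
  is_iso v -> is_iso u -> is_iso (compm v u).
Proof.
move=> [v' [v'v vv']] [u' [u'u uu']]; exists (compm u' v'); split.
  by rewrite compmA -(compmA u') v'v compm1.
by rewrite compmA -(compmA v) uu' compm1.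
Qed.

Fact isomorphic_refl x : isomorphic x x.
Proof. by exists (idm x); apply: is_iso_id. Qed.

Fact isomorphic_sym x y : isomorphic x y -> isomorphic y x.
Proof. by move=> [u [v [vu uv]]]; exists v, u. Qed.

Fact isomorphic_trans x y z : isomorphic x y -> isomorphic y z -> isomorphic x z.
Proof. by move=> [u iu] [v iv]; exists (compm v u); apply: is_iso_comp. Qed.

Definition isomorphicb : rel {classic Gam} := fun x y => `[< isomorphic x y >].

Fact isomorphicb_equiv : equiv_class_of isomorphicb.
Proof.
split=> [x|x y|y x z]; first by apply/asboolP/isomorphic_refl.
  by apply/asboolP/asboolP; apply: isomorphic_sym.
move=> /asboolP xy /asboolP yz; apply/asboolP.
exact: isomorphic_trans xy yz.
Qed.

Canonical isomorphicb_rel := EquivRelPack isomorphicb_equiv.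

Definition iso_classes := {eq_quot isomorphicb}.
HB.instance Definition _ := Choice.on iso_classes.

Definition iso_class (x : Gam) : iso_classes :=
  \pi_({eq_quot isomorphicb}) (x : {classic Gam}).
Definition iso_repr (X : iso_classes) : Gam :=
  (repr (X : {eq_quot isomorphicb}) : {classic Gam}).

Lemma iso_classP x y : iso_class x = iso_class y <-> isomorphic x y.
Proof.
split=> [/eqP|xy]; first by rewrite eqmodE => /asboolP.
by apply/eqP; rewrite eqmodE; apply/asboolP.
Qed.

Lemma iso_reprK X : iso_class (iso_repr X) = X.
Proof. exact: reprK. Qed.

Section Automorphisms.
Variable x : Gam.

Definition aut := {u : hom x x | is_iso u}.
HB.instance Definition _ := gen_eqMixin aut.
HB.instance Definition _ := gen_choiceMixin aut.

Lemma aut_inj (u v : aut) : sval u = sval v -> u = v.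
Proof.
case: u v => [u pu] [v pv] /= uv; subst v.
by congr exist; apply: Prop_irrelevance.
Qed.

Definition aut_one : aut := exist _ (idm x) (is_iso_id x).

Definition aut_mul (v u : aut) : aut :=
  exist _ (compm (sval v) (sval u)) (is_iso_comp (svalP v) (svalP u)).

Fact aut_inv_subproof (u : aut) : is_iso (sval (cid (svalP u))).
Proof. by case: cid => v [vu uv]; exists (sval u). Qed.

Definition aut_inv (u : aut) : aut := exist _ _ (aut_inv_subproof u).

Fact aut_mulA : associative aut_mul.
Proof. by move=> u v w; apply: aut_inj => /=; rewrite compmA. Qed.

Fact aut_mul1l : left_id aut_one aut_mul.
Proof. by move=> u; apply: aut_inj => /=; rewrite comp1m. Qed.

Fact aut_mul1r : right_id aut_one aut_mul.
Proof. by move=> u; apply: aut_inj => /=; rewrite compm1. Qed.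

Fact aut_mulVl : left_inverse aut_one aut_inv aut_mul.
Proof. by move=> u; apply: aut_inj => /=; case: cid => v []. Qed.

Fact aut_mulVr : right_inverse aut_one aut_inv aut_mul.
Proof. by move=> u; apply: aut_inj => /=; case: cid => v []. Qed.

HB.instance Definition _ := isGroup.Build aut
  aut_mulA aut_mul1l aut_mul1r aut_mulVl aut_mulVr.

End Automorphisms.
End Categories.

Record functor (C D : category) := Functor {
  fob :> C -> D;
  fmap : forall x y, hom x y -> hom (fob x) (fob y);
  fmap_id : forall x, fmap (idm x) = idm (fob x);
  fmap_comp : forall x y z (v : hom y z) (u : hom x y),
    fmap (compm v u) = compm (fmap v) (fmap u)
}.

(* Naturally isomorphic to the identity, resp. G o F naturally isomorphic to  *)
(* the identity.                                                              *)
Definition comp_iso_id (C D : category) (F : functor C D) (G : functor D C) :=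
  exists eta : forall x : C, hom x (G (F x)),
    (forall x, is_iso (eta x)) /\
    (forall x y (u : hom x y),
      compm (eta y) u = compm (fmap G (fmap F u)) (eta x)).

Definition is_equivalence (C D : category) (F : functor C D) : Prop :=
  exists G : functor D C, comp_iso_id F G /\ comp_iso_id G F.

Definition equivalent (C D : category) : Prop :=
  exists F : functor C D, is_equivalence F.

Section Modules.
Variables (R : realType) (Gam : category).
Local Notation C := R[i].

Record cmodule := CModule {
  cm_ob :> Gam -> lmodType C;
  cm_map : forall x y, hom x y -> {linear cm_ob y -> cm_ob x};
  cm_id : forall x m, cm_map (idm x) m = m;
  cm_comp : forall x y z (v : hom y z) (u : hom x y) m,
    cm_map (compm v u) m = cm_map u (cm_map v m)
}.

Record cmorphism (M N : cmodule) := CMorphism {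
  cmor :> forall x, {linear M x -> N x};
  cmor_nat : forall x y (u : hom x y) m,
    cmor x (cm_map M u m) = cm_map N u (cmor y m)
}.

Section Constant.

Fact const_id (x : Gam) (m : C^o) : idfun m = m. Proof. by []. Qed.

Definition const_cmodule : cmodule :=
  @CModule (fun=> C^o) (fun _ _ _ => idfun) const_id (fun _ _ _ _ _ _ => erefl).

End Constant.

Section Representable.
Variable x : Gam.

Definition rep_ob (y : Gam) : lmodType C := {malg C[{classic hom y x}]}.

Definition rep_map y z (u : hom y z) : {linear rep_ob z -> rep_ob y} :=
  malg_lift (fun f : {classic hom z x} =>
    << (compm (f : hom z x) u : {classic hom y x}) >> : rep_ob y).

Fact rep_map_id y m : rep_map (idm y) m = m.
Proof.
elim/malg_ind: m => [a b c ha hb||f]; rewrite ?linear0 //.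
  by rewrite linearP ha hb.
by rewrite /rep_map /= malg_liftU compm1.
Qed.

Fact rep_map_comp y z t (v : hom z t) (u : hom y z) m :
  rep_map (compm v u) m = rep_map u (rep_map v m).
Proof.
elim/malg_ind: m => [a b c ha hb||f]; rewrite ?linear0 //.
  by rewrite !linearP ha hb.
by rewrite /rep_map /= !malg_liftU compmA.
Qed.

Definition representable : cmodule := CModule rep_map_id rep_map_comp.

End Representable.
End Modules.

Section DirectSum.
Variables (A : pzRingType) (I : Type) (M : I -> lmodType A).

Definition dprod := forall i, M i.
HB.instance Definition _ := gen_eqMixin dprod.
HB.instance Definition _ := gen_choiceMixin dprod.

Implicit Types f g : dprod.

Definition dprod_zero : dprod := fun=> 0.
Definition dprod_opp f : dprod := fun i => - f i.
Definition dprod_add f g : dprod := fun i => f i + g i.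
Definition dprod_scale (c : A) f : dprod := fun i => c *: f i.

Fact dprod_addA : associative dprod_add.
Proof. by move=> f g h; apply: functional_extensionality_dep => i; apply: addrA. Qed.

Fact dprod_addC : commutative dprod_add.
Proof. by move=> f g; apply: functional_extensionality_dep => i; apply: addrC. Qed.

Fact dprod_add0 : left_id dprod_zero dprod_add.
Proof. by move=> f; apply: functional_extensionality_dep => i; apply: add0r. Qed.

Fact dprod_addN : left_inverse dprod_zero dprod_opp dprod_add.
Proof. by move=> f; apply: functional_extensionality_dep => i; apply: addNr. Qed.

HB.instance Definition _ := GRing.isZmodule.Build dprod
  dprod_addA dprod_addC dprod_add0 dprod_addN.

Fact dprod_scaleA c d f : dprod_scale c (dprod_scale d f) = dprod_scale (c * d) f.
Proof. by apply: functional_extensionality_dep => i; apply: scalerA. Qed.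

Fact dprod_scale1 : left_id 1 dprod_scale.
Proof. by move=> f; apply: functional_extensionality_dep => i; apply: scale1r. Qed.

Fact dprod_scaleDr : right_distributive dprod_scale +%R.
Proof. by move=> c f g; apply: functional_extensionality_dep => i; apply: scalerDr. Qed.

Fact dprod_scaleDl f : {morph dprod_scale^~ f : c d / c + d}.
Proof. by move=> c d; apply: functional_extensionality_dep => i; apply: scalerDl. Qed.

HB.instance Definition _ := GRing.Zmodule_isLmodule.Build A dprod
  dprod_scaleA dprod_scale1 dprod_scaleDr dprod_scaleDl.

Definition dsum_pred : {pred dprod} :=
  fun f => `[< finite_set [set i | f i != 0] >].

Fact dsum_submod_closed : submod_closed dsum_pred.
Proof.
split=> [|c f g /asboolP hf /asboolP hg]; apply/asboolP.
  apply: (@sub_finite_set _ _ set0); last exact: finite_set0.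
  by move=> i /=; rewrite eqxx.
apply: (@sub_finite_set _ _ ([set i | f i != 0] `|` [set i | g i != 0])).
  move=> i /=; rewrite -[(c *: f + g) i]/(c *: f i + g i).
  have [->|] := eqVneq (f i) 0; last by left.
  by rewrite scaler0 add0r; right.
by rewrite finite_setU.
Qed.

HB.instance Definition _ := GRing.isSubmodClosed.Build A dprod dsum_pred
  dsum_submod_closed.

Definition dsum : lmodType A := submodule (dsum_pred : submodClosed dprod).

End DirectSum.

Section DirectSumMap.
Variables (A : pzRingType) (I : Type) (M N : I -> lmodType A).
Variable f : forall i, {linear M i -> N i}.

Fact dsum_map_subproof (m : dsum M) :
  (fun i => f i (val m i) : N i) \in @dsum_pred A I N.
Proof.
apply/asboolP; have /asboolP := valP m.
apply: sub_finite_set => i /=; apply: contra_neq => ->.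
by rewrite linear0.
Qed.

Definition dsum_map (m : dsum M) : dsum N :=
  exist (fun g => g \in @dsum_pred A I N) _ (dsum_map_subproof m).

Fact dsum_map_is_linear : linear dsum_map.
Proof.
move=> c m n; apply: val_inj; apply: functional_extensionality_dep => i /=.
exact: linearP.
Qed.

HB.instance Definition _ := GRing.isLinear.Build A (dsum M) (dsum N) *:%R
  dsum_map dsum_map_is_linear.

End DirectSumMap.

Section Resolutions.
Variables (R : realType) (Gam : category).
Local Notation C := R[i].
Local Notation cmodule := (cmodule R Gam).

Section DirectSumModule.
Variables (I : Type) (M : I -> cmodule).

Let ob y := dsum (fun i => M i y).

Definition dsum_cmap y z (u : hom y z) : {linear ob z -> ob y} :=
  dsum_map (fun i => cm_map (M i) u).

Fact dsum_cid y m : dsum_cmap (idm y) m = m.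
Proof.
apply: val_inj; apply: functional_extensionality_dep => i /=.
exact: cm_id.
Qed.

Fact dsum_ccomp y z t (v : hom z t) (u : hom y z) m :
  dsum_cmap (compm v u) m = dsum_cmap u (dsum_cmap v m).
Proof.
apply: val_inj; apply: functional_extensionality_dep => i /=.
exact: cm_comp.
Qed.

Definition dsum_cmodule : cmodule := CModule dsum_cid dsum_ccomp.

End DirectSumModule.

Definition direct_summand (P Q : cmodule) : Prop :=
  exists (s : cmorphism P Q) (r : cmorphism Q P),
    forall x m, r x (s x m) = m.

Definition projective (P : cmodule) : Prop :=
  exists (I : Type) (x : I -> Gam),
    direct_summand P (dsum_cmodule (fun i => representable R (x i))).

Record resolution := Resolution {
  res_ob :> nat -> cmodule;
  res_d : forall n, cmorphism (res_ob n.+1) (res_ob n);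
  res_aug : cmorphism (res_ob 0) (const_cmodule R Gam);
  res_proj : forall n, projective (res_ob n);
  res_aug_surj : forall x c, exists m, res_aug x m = c;
  res_exact0 : forall x m, res_aug x m = 0 <-> exists m', res_d 0 x m' = m;
  res_exactS : forall n x m,
    res_d n x m = 0 <-> exists m', res_d n.+1 x m' = m
}.

End Resolutions.

Section Splitting.
Variables (R : realType) (Gam : category).
Local Notation C := R[i].

Section AtObject.
Variables (M : cmodule R Gam) (x : Gam).
Local Notation CG := (group_algebra C (aut x)).

(* M(x) as a right C[x]-module: m.u = M(u)(m). *)
Definition at_obj : Type := M x.
HB.instance Definition _ := Choice.on at_obj.
HB.instance Definition _ := GRing.Zmodule.on at_obj.

Definition at_act (a : CG^c) (m : at_obj) : at_obj :=
  malg_lift (fun u : aut x => cm_map M (sval u) m : M x) (a : CG).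

Lemma at_actU (u : aut x) m : at_act (ga_elt C u) m = cm_map M (sval u) m.
Proof. by rewrite /at_act malg_liftU. Qed.

Fact at_actDl m : {morph at_act^~ m : a b / a + b}.
Proof. by move=> a b; rewrite /at_act linearD. Qed.

Lemma at_actZl c a m : at_act (c *: (a : CG)) m = c *: (at_act a m : M x).
Proof. by rewrite /at_act linearZ. Qed.

Lemma at_act0 m : at_act 0 m = 0.
Proof. by rewrite /at_act linear0. Qed.

Lemma at_actP (a : CG^c) c (m n : M x) :
  at_act a (c *: m + n) = c *: (at_act a m : M x) + at_act a n :> M x.
Proof.
rewrite /at_act -malg_lift_fun; congr malg_lift; apply/funext => u.
exact: linearP.
Qed.

Fact at_actDr : right_distributive at_act +%R.
Proof.
by move=> a m n; have := at_actP a 1 m n; rewrite !scale1r.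
Qed.

Fact at_act1 : left_id 1 at_act.
Proof. by move=> m; rewrite at_actU /= cm_id. Qed.

Fact at_actA (a b : CG^c) m : at_act a (at_act b m) = at_act (a * b) m.
Proof.
rewrite -[a * b]/(ga_mul (b : CG) (a : CG)).
elim/ga_ind: b => [b b' c hb hb'||v].
- by rewrite ga_mulPl !at_actDl !at_actZl at_actP hb hb'.
- rewrite ga_mul0l !at_act0.
  by apply: (addrI (at_act a 0)); rewrite -at_actDr !addr0.
elim/ga_ind: a => [a a' c ha ha'||u].
- by rewrite ga_mulPr !at_actDl !at_actZl ha ha'.
- by rewrite ga_mul0r !at_act0.
by rewrite ga_mulU !at_actU /= cm_comp.
Qed.

HB.instance Definition _ := GRing.Zmodule_isLmodule.Build CG^c at_obj
  at_actA at_act1 at_actDr at_actDl.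

End AtObject.

(* The images of the M(u) : M(y) -> M(x), for u : x -> y not an isomorphism.  *)
Definition noniso_images (M : cmodule R Gam) (x : Gam) : set (at_obj M x) :=
  [set m | exists y (u : hom x y), ~ is_iso u /\ exists n : M y,
     m = cm_map M u n].

Definition splitting (M : cmodule R Gam) (x : Gam) :
    lmodType (group_algebra C (aut x))^c :=
  quotmod (span (@noniso_images M x)).

Section SplittingMap.
Variables (M N : cmodule R Gam) (f : cmorphism M N) (x : Gam).

Definition at_map (m : at_obj M x) : at_obj N x := f x m.

Fact at_map_is_linear : linear at_map.
Proof.
move=> a m n; rewrite /at_map [LHS](linearD (f x)) /=; congr (_ + _).
rewrite -[a *: m]/(at_act a m) -[RHS]/(at_act a (f x m)).
elim/ga_ind: a => [a a' c ha ha'||u].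
- by rewrite !at_actDl !at_actZl [LHS](linearP (f x)) ha ha'.
- by rewrite !at_act0 [LHS](linear0 (f x)).
by rewrite !at_actU cmor_nat.
Qed.

HB.instance Definition _ := GRing.isLinear.Build (group_algebra C (aut x))^c
  (at_obj M x) (at_obj N x) *:%R at_map at_map_is_linear.

Fact splitting_map_rel m :
  m \in span (@noniso_images M x) -> at_map m \in span (@noniso_images N x).
Proof.
apply: span_map => {}m [y [u [nu [n ->]]]]; apply: mem_span.
by exists y, u; split=> //; exists (f y n); rewrite /= /at_map cmor_nat.
Qed.

Definition splitting_map : {linear splitting M x -> splitting N x} :=
  quot_map splitting_map_rel.

End SplittingMap.

Section SplittingComplex.
Variables (P : resolution R Gam) (x : Gam).

Fact splitting_dd n m :
  splitting_map (res_d P n) x (splitting_map (res_d P n.+1) x m) = 0.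
Proof.
rewrite -(quot_proj_repr m) /splitting_map /= !quot_mapE /= /at_map.
have -> : res_d P n x (res_d P n.+1 x (repr m)) = 0.
  by apply/res_exactS; exists (repr m).
exact: linear0.
Qed.

Definition splitting_cpx : chain_complex (group_algebra C (aut x))^c :=
  ChainComplex splitting_dd.

End SplittingComplex.

End Splitting.

Section Dimension.
Variables (R : realType) (G : groupType).
Local Notation N := (vN R G).

Section IdempotentImage.
Variables (n : nat) (A : 'M[N]_n).


(* A.N^n for the left action of A on columns, a right submodule of N^n.       *)
Definition mx_image_pred : {pred 'cV[N^c]_n} :=
  fun w => `[< exists v : 'cV[N]_n, w = (A *m v : 'cV[N]_n) >].

Fact mx_image_submod_closed : submod_closed mx_image_pred.
Proof.
split=> [|a w w' /asboolP[v ->] /asboolP[v' ->]]; apply/asboolP.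
  by exists 0; rewrite mulmx0.
exists (\col_k (v k 0 * (a : N) + v' k 0)).
apply/matrixP => i j; rewrite (ord1 j) !mxE.
rewrite -[LHS]/((\sum_k A i k * v k 0) * (a : N) + \sum_k A i k * v' k 0).
rewrite mulr_suml -big_split /=; apply: eq_bigr => k _.
by rewrite mxE mulrDr mulrA.
Qed.

HB.instance Definition _ := GRing.isSubmodClosed.Build N^c 'cV[N^c]_n
  mx_image_pred mx_image_submod_closed.

Definition mx_image : submodClosed 'cV[N^c]_n := mx_image_pred.

End IdempotentImage.

Definition fgproj_dim (M : lmodType N^c) (d : R) : Prop :=
  exists n (A : 'M[N]_n), [/\ A *m A = A,
    exists f : {linear submodule (mx_image A) -> M}, bijective f &
    \sum_(i < n) vN_tr (A i i) = d%:C%C].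

Definition vN_dim (M : lmodType N^c) : \bar R :=
  ereal_sup [set d%:E | d in
    [set d | exists L : submodClosed M, fgproj_dim (submodule L) d]].

Lemma vN_dim_ge0 M : (0 <= vN_dim M)%E.
Proof.
apply: ereal_sup_ubound; exists 0 => //.
pose P : {pred M} := fun m => m == 0.
have PS : submod_closed P.
  split=> [|c x y]; rewrite !unfold_in /= ?eqxx // => /eqP -> /eqP ->.
  by rewrite scaler0 addr0.
pose B := GRing.isSubmodClosed.Build N^c M P PS.
pose L : submodClosed M := HB.pack P B.
exists L, 0%N, (0 : 'M[N]_0); split; first by rewrite mulmx0.
  exists \0; exists (fun=> 0) => [x|x].
    by apply: val_inj; apply/matrixP => -[].
  have /eqP h : val x == 0 := valP x.
  by apply: val_inj; rewrite h.
by rewrite big_ord0.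
Qed.

Section ChainComplex.
Variable K : chain_complex N^c.

Definition cpx_h2 : \bar R := (\sum_(0 <= p <oo) vN_dim (homology K p))%E.

Definition cpx_chi2 : R :=
  limn (series (fun p => (-1) ^+ p * fine (vN_dim (homology K p)))).

Lemma cpx_h2_ge0 : (0 <= cpx_h2)%E.
Proof. by apply: nneseries_ge0 => p _ _; apply: vN_dim_ge0. Qed.

Lemma normr_cpx_chi2 : (`|cpx_chi2|%:E <= cpx_h2)%E.
Proof.
have [->|hfin] := eqVneq cpx_h2 +oo%E; first exact: leey.
pose a p := vN_dim (homology K p).
have a0 p : (0 <= a p)%E by apply: vN_dim_ge0.
have ha : esum.summable (fun p : nat => true) a.
  rewrite /esum.summable -nneseries_esum; last by move=> p _; apply: abse_ge0.
  rewrite ltey; apply: contra_neq hfin => <-.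
  by apply: eq_eseriesr => p _; rewrite gee0_abs.
rewrite /cpx_h2 (summable_nneseries_lim _ ha) //.
rewrite lee_fin.
pose b p := (-1) ^+ p * fine (a p).
have nb p : `|b p| = fine (a p).
  by rewrite normrM normrX normrN1 expr1n mul1r ger0_norm ?fine_ge0.
have cb : cvgn [normed series b].
  have := summable_cvg (fun p _ => a0 p) ha.
  rewrite (_ : (fun n => _) = [normed series b]) //.
  by apply/funext => n; apply: eq_bigr => p _; apply/esym/nb.
apply: le_trans (lim_series_norm cb) _.
rewrite le_eqVlt; apply/orP; left; apply/eqP; congr (limn _).
by apply/funext => n; apply: eq_bigr => p _; apply: nb.
Qed.

End ChainComplex.
End Dimension.

Section L2EulerCharacteristic.
Variable R : realType.
Local Notation C := R[i].

(* S_x P_* (x)_{C[x]} N(x)                                                    *)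
Definition l2_cpx (Gam : category) (P : resolution R Gam) (x : Gam) :
    chain_complex (vN R (aut x))^c :=
  tensor_cpx (@ga_vN R (aut x)) (splitting_cpx P x).

Definition h2_total (Gam : category) (P : resolution R Gam) : \bar R :=
  (\esum_(X in [set: iso_classes Gam]) cpx_h2 (l2_cpx P (iso_repr X)))%E.

Definition type_L2 (Gam : category) : Prop :=
  exists P : resolution R Gam, (h2_total P < +oo)%E.

Record U1 (Gam : category) := MkU1 {
  U1_fun :> iso_classes Gam -> R;
  U1_summable : esum.summable [set: iso_classes Gam] (EFin \o U1_fun)
}.

Section Chi.
Variables (Gam : category) (HG : type_L2 Gam).

Definition chi_resolution : resolution R Gam := sval (cid HG).

Let chi_fun (X : iso_classes Gam) : R :=
  cpx_chi2 (l2_cpx chi_resolution (iso_repr X)).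

Fact chi2_f_summable : esum.summable [set: iso_classes Gam] (EFin \o chi_fun).
Proof.
apply: le_lt_trans (svalP (cid HG)); apply: le_esum => X _ /=.
exact: normr_cpx_chi2.
Qed.

Definition chi2_f : U1 Gam := MkU1 chi2_f_summable.

Definition chi2 : R := summability.sum (chi2_f : iso_classes Gam -> R).

End Chi.

Section Functoriality.
Variables (Gam1 Gam2 : category) (F : functor Gam1 Gam2).

Definition iso_map (X : iso_classes Gam1) : iso_classes Gam2 :=
  iso_class (F (iso_repr X)).

Lemma fmap_iso x y : isomorphic x y -> isomorphic (F x) (F y).
Proof.
move=> [u [v [vu uv]]]; exists (fmap F u), (fmap F v).
by rewrite -!fmap_comp vu uv !fmap_id.
Qed.

Lemma iso_map_class x : iso_map (iso_class x) = iso_class (F x).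
Proof. by apply/iso_classP/fmap_iso/iso_classP; rewrite iso_reprK. Qed.

End Functoriality.

Lemma iso_map_bij (Gam1 Gam2 : category) (F : functor Gam1 Gam2) :
  is_equivalence F -> set_bij [set: iso_classes Gam1] [set: iso_classes Gam2]
    (iso_map F).
Proof.
move=> [G [[eta [eta_iso _]] [eps [eps_iso _]]]]; split=> [//|X Y _ _|Y _].
  move=> /iso_classP FXY.
  rewrite -(iso_reprK X) -(iso_reprK Y); apply/iso_classP.
  have GFXY := fmap_iso G FXY.
  apply: isomorphic_trans (ex_intro _ _ (eta_iso _)) _.
  apply: isomorphic_trans GFXY _; apply: isomorphic_sym.
  exact: ex_intro (eta_iso _).
exists (iso_class (G (iso_repr Y))) => //.
rewrite iso_map_class -[RHS]iso_reprK; apply/iso_classP/isomorphic_sym.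
exact: ex_intro (eps_iso _).
Qed.

Section U1Map.
Variables (Gam1 Gam2 : category) (F : functor Gam1 Gam2).
Hypothesis HF : is_equivalence F.

Fact iso_map_surj Y : exists X, iso_map F X = Y.
Proof. by have [_ _ /(_ Y I)[X _ <-]] := iso_map_bij HF; exists X. Qed.

Definition iso_map_inv (Y : iso_classes Gam2) : iso_classes Gam1 :=
  sval (cid (iso_map_surj Y)).

Lemma iso_mapK : cancel iso_map_inv (iso_map F).
Proof. by move=> Y; rewrite /iso_map_inv; case: cid. Qed.

Lemma iso_map_invK : cancel (iso_map F) iso_map_inv.
Proof.
have [_ inj _] := iso_map_bij HF.
by move=> X; apply: inj; rewrite ?in_setT // iso_mapK.
Qed.

Fact U1_map_subproof (r : U1 Gam1) :
  esum.summable [set: iso_classes Gam2] (EFin \o (r \o iso_map_inv)).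
Proof.
rewrite /esum.summable (reindex_esum setT setT (iso_map F)); last first.
  exact: iso_map_bij.
by under eq_esum do rewrite /= iso_map_invK; apply: U1_summable.
Qed.

Definition U1_map (r : U1 Gam1) : U1 Gam2 := MkU1 (U1_map_subproof r).

End U1Map.
End L2EulerCharacteristic.

(* Main.v *)
From HB Require Import structures.
From mathcomp Require Import all_boot all_order all_algebra.
From mathcomp Require Import finmap monalg complex.
From mathcomp Require Import all_classical all_reals ereal esum.
From mathcomp Require Import normedtype sequences.
From mathcomp Require summability.
Require Import Defs.

(** Write T_x M for the N(aut x)-module obtained from a module M over the
    category by splitting at x and extending scalars to N(aut x).  The
    invariants in the statement only see the numbers
    dim H_n (T_x P), where P is a projective resolution of the constant module
    and x an object; so everything reduces to showing that these numbers depend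
    neither on P, nor on x within its isomorphism class, nor on the category
    within its equivalence class.

    Independence of P is the fundamental lemma of homological algebra.  Modules
    that are summands of sums of representables lift along objectwise
    surjections (projective_lift, by the Yoneda lemma), so two resolutions are
    chain homotopy equivalent.  Since T_x is additive, the homotopy equivalence
    survives T_x and gives isomorphic homology (l2_homology_resolution).

    For an equivalence F from Gam1 to Gam2 with quasi-inverse G, restriction
    along F sends a resolution P over Gam2 to a resolution over Gam1: exactness
    is objectwise, and the restriction of mor(?, y) is a summand of mor(?, G y)
    (restrict_representable).  Given an isomorphism w from y to F x, the map
    P_n(w) together with conjugation by w, which identifies aut x with aut y,
    is a chain isomorphism from T_x (F^* P) to T_y P.  It is not linear but
    semilinear along the induced ring isomorphism N(aut x) = N(aut y)
    (l2_homology_restrict); as that ring isomorphism preserves the trace, it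
    preserves the dimension (vN_dim_semi_iso).  Both steps together give
    vN_dim_homology_equivalence.

    Type (L^2), the functional Euler characteristic and its total then follow by
    reindexing sums along the bijection of isomorphism classes induced by F.
    Direct finiteness passes along F because F is faithful. *)

Set Implicit Arguments.
Unset Strict Implicit.
Unset Printing Implicit Defensive.

Import Order.TTheory GRing.Theory Num.Theory numFieldNormedType.Exports.

Local Open Scope classical_set_scope.
Local Open Scope ring_scope.

(** * Semilinear maps, quotients and homology *)

Section Semilinear.
Variables (A B : pzRingType) (rho : A -> B).

(** An isomorphism between two automorphism groups changes the ring of scalars,
    so the maps it induces are linear only up to the twist [rho]. *)
Definition semilinear (M : lmodType A) (N : lmodType B) (f : M -> N) : Prop :=
  {morph f : x y / x + y} /\ forall a m, f (a *: m) = rho a *: f m.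

Definition semi_iso (M : lmodType A) (N : lmodType B) : Prop :=
  exists f : M -> N, semilinear f /\ bijective f.

End Semilinear.

Section Additive.
Variables (M N : zmodType) (f : M -> N).
Hypothesis fD : {morph f : x y / x + y}.

Lemma morphD0 : f 0 = 0.
Proof. by apply: (addrI (f 0)); rewrite -fD !addr0. Qed.

Lemma morphDN x : f (- x) = - f x.
Proof. by apply: (addrI (f x)); rewrite -fD !subrr morphD0. Qed.

Lemma morphDB x y : f (x - y) = f x - f y.
Proof. by rewrite fD morphDN. Qed.

End Additive.

Lemma bij_morphD (M N : zmodType) (f : M -> N) (g : N -> M) :
  {morph f : x y / x + y} -> cancel f g -> cancel g f ->
  {morph g : x y / x + y}.
Proof. by move=> fD fK gK x y; apply: (can_inj fK); rewrite fD !gK. Qed.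

Lemma linear_semilinear (A : pzRingType) (M N : lmodType A)
  (f : {linear M -> N}) : semilinear id f.
Proof. by split; [exact: linearD | move=> a m; rewrite linearZ]. Qed.

(** The preimage of [span X'] under a semilinear map is again a submodule. *)
Lemma span_semilinear (A B : pzRingType) (rho : A -> B)
    (M : lmodType A) (M' : lmodType B) (X : set M) (X' : set M') (f : M -> M') :
  semilinear rho f -> (forall x, X x -> f x \in span X') ->
  forall m, m \in span X -> f m \in span X'.
Proof.
move=> [fD fZ] fX m /asboolP mX.
pose P : {pred M} := fun m => f m \in span X'.
have PE x : (x \in P) = (f x \in span X') by [].
have PS : submod_closed P.
  split=> [|c x y]; rewrite !PE ?(morphD0 fD) ?rpred0 // fD fZ => hx hy.
  by apply: rpredD => //; apply: rpredZ.
pose K := GRing.isSubmodClosed.Build A M P PS.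
pose N : submodClosed M := HB.pack P K.
exact: (mX N fX).
Qed.

Section QuotientMap.
Variables (A B : pzRingType) (rho : A -> B).
Variables (M : lmodType A) (M' : lmodType B).
Variables (N : submodClosed M) (N' : submodClosed M').

Definition quot_smap (f : M -> M') (q : quotmod N) : quotmod N' :=
  quot_proj N' (f (repr q)).

Lemma quot_smapE f m : {morph f : x y / x + y} ->
  (forall m, m \in N -> f m \in N') ->
  quot_smap f (quot_proj N m) = quot_proj N' (f m).
Proof.
move=> fD fN; apply/quot_proj_eq; rewrite -(morphDB fD); apply: fN.
by apply/quot_proj_eq; rewrite quot_proj_repr.
Qed.

Lemma quot_smap_semilinear f : semilinear rho f ->
  (forall m, m \in N -> f m \in N') -> semilinear rho (quot_smap f).
Proof.
move=> [fD fZ] fN; split=> [p q|a p].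
  rewrite -(quot_proj_repr p) -(quot_proj_repr q) -linearD.
  by rewrite !quot_smapE // fD linearD.
by rewrite -(quot_proj_repr p) -linearZ !quot_smapE // fZ linearZ.
Qed.

End QuotientMap.

Lemma quot_semi_iso (A B : pzRingType) (rho : A -> B)
    (M : lmodType A) (M' : lmodType B)
    (N : submodClosed M) (N' : submodClosed M') (f : M -> M') (g : M' -> M) :
  semilinear rho f -> {morph g : x y / x + y} ->
  (forall m, m \in N -> f m \in N') -> (forall m, m \in N' -> g m \in N) ->
  (forall m, g (f m) - m \in N) -> (forall m, f (g m) - m \in N') ->
  semi_iso rho (quotmod N) (quotmod N').
Proof.
move=> fS gD fN gN gf fg; exists (quot_smap N' f); split.
  exact: quot_smap_semilinear.
have fD := fS.1.
exists (quot_smap N g) => q; rewrite -(quot_proj_repr q) !quot_smapE //.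
  exact/quot_proj_eq.
exact/quot_proj_eq.
Qed.

(** Being inverse to each other on cycles up to boundaries is the common form of
    two situations: a chain homotopy equivalence, with [rho] the identity, and
    a semilinear isomorphism of complexes, with vanishing homotopies. *)
Section HomologyEquivalence.
Variables (A B : pzRingType) (rho : A -> B).
Variables (K : chain_complex A) (L : chain_complex B).
Variables (f : forall n, K n -> L n) (g : forall n, L n -> K n).
Hypothesis fS : forall n, semilinear rho (@f n).
Hypothesis gD : forall n, {morph @g n : x y / x + y}.
Hypothesis fd : forall n x, f (cpx_d K n x) = cpx_d L n (f x).
Hypothesis gd : forall n x, g (cpx_d L n x) = cpx_d K n (g x).
Hypothesis gf : forall n z, z \in cycles K n ->
  exists y, cpx_d K n y = g (f z) - z.
Hypothesis fg : forall n z, z \in cycles L n ->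
  exists y, cpx_d L n y = f (g z) - z.

Let f_cycles n z : z \in cycles K n -> f z \in cycles L n.
Proof.
case: n z => [//|n] z /eqP hz; apply/eqP.
by rewrite -fd hz (morphD0 (fS n).1).
Qed.

Let g_cycles n z : z \in cycles L n -> g z \in cycles K n.
Proof.
case: n z => [//|n] z /eqP hz; apply/eqP.
by rewrite -gd hz (morphD0 (@gD n)).
Qed.

Let fZ n (z : submodule (cycles K n)) : submodule (cycles L n) :=
  exist _ (f (val z)) (f_cycles (valP z)).
Let gZ n (z : submodule (cycles L n)) : submodule (cycles K n) :=
  exist _ (g (val z)) (g_cycles (valP z)).

Lemma homology_semi_iso n : semi_iso rho (homology K n) (homology L n).
Proof.
apply: (@quot_semi_iso _ _ rho _ _ (boundaries K n) (boundaries L n)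
  (@fZ n) (@gZ n)).
- split=> [x y|a x]; apply: val_inj => /=; first exact: (fS n).1.
  exact: (fS n).2.
- by move=> x y; apply: val_inj => /=; apply: gD.
- move=> z /asboolP[y hy]; apply/asboolP; exists (f y).
  by rewrite -fd hy.
- move=> z /asboolP[y hy]; apply/asboolP; exists (g y).
  by rewrite -gd hy.
- by move=> z; apply/asboolP; have [y hy] := gf (valP z); exists y.
- by move=> z; apply/asboolP; have [y hy] := fg (valP z); exists y.
Qed.

End HomologyEquivalence.

(** * Reindexing unconditional sums *)

Section SumReindex.
Variables (K : numDomainType) (V : normedModType K).

Lemma partial_sum_imfset (I J : choiceType) (s : J -> I) (x : I -> V)
    (A : {fset J}) : injective s ->
  summability.partial_sum (x \o s) A = summability.partial_sum x (s @` A)%fset.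
Proof.
move=> s_inj; rewrite /summability.partial_sum.
rewrite -(big_seq_fsetE _ _ (fun _ => true) (x \o s)).
rewrite -(big_seq_fsetE _ _ (fun _ => true) x).
by rewrite big_imfset //= => i j _ _; apply: s_inj.
Qed.

Let sub_reindex (I J : choiceType) (s : J -> I) (s' : I -> J) (x : I -> V) :
  cancel s s' -> cancel s' s ->
  summability.partial_sum (x \o s) @ summability.totally `<=`
  summability.partial_sum x @ summability.totally.
Proof.
move=> sK s'K E [A0 _ hA0]; exists (s @` A0)%fset => // B /= hB.
have -> : B = (s @` (s' @` B))%fset.
  apply/fsetP => i; apply/idP/imfsetP => /= [iB|[j /imfsetP[k /= kB ->] ->]].
    by exists (s' i); rewrite ?s'K // in_imfset.
  by rewrite s'K.
rewrite -partial_sum_imfset; last exact: can_inj sK.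
apply: hA0 => /=; apply/fsubsetP => j jA0; rewrite -(sK j) in_imfset //=.
by apply: (fsubsetP hB); rewrite in_imfset.
Qed.

(** A bijection of the index sets identifies the two image filters of partial
    sums, hence also their limits. *)
Lemma reindex_sum (I J : choiceType) (s : J -> I) (s' : I -> J) (x : I -> V) :
  cancel s s' -> cancel s' s -> summability.sum (x \o s) = summability.sum x.
Proof.
move=> sK s'K; rewrite /summability.sum; congr (lim _).
apply/seteqP; split; first exact: sub_reindex s'K.
have {1}-> : x = (x \o s) \o s' by apply/funext => i /=; rewrite s'K.
exact: sub_reindex sK.
Qed.

End SumReindex.

(** * Group von Neumann algebras of isomorphic groups *)

Record group_iso (G H : groupType) := GroupIso {
  giso_fun :> G -> H;
  giso_inv : H -> G;
  gisoK : cancel giso_fun giso_inv;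
  gisoVK : cancel giso_inv giso_fun;
  gisoM : {morph giso_fun : x y / (x * y)%g}
}.

Section GroupIsoTheory.
Variables (G H : groupType) (th : group_iso G H).

Lemma giso1 : th 1%g = 1%g.
Proof. by apply: (mulgI (th 1%g)); rewrite -gisoM !mulg1. Qed.

Lemma gisoV x : th x^-1%g = (th x)^-1%g.
Proof. by apply: (mulgI (th x)); rewrite -gisoM !mulgV giso1. Qed.

Fact giso_invM : {morph giso_inv th : x y / (x * y)%g}.
Proof. by move=> x y; apply: (can_inj (gisoK th)); rewrite gisoM !gisoVK. Qed.

Definition giso_sym : group_iso H G := GroupIso (gisoVK th) (gisoK th) giso_invM.

Lemma giso_inv1 : giso_inv th 1%g = 1%g. Proof. by rewrite -giso1 gisoK. Qed.

Lemma giso_invV x : giso_inv th x^-1%g = (giso_inv th x)^-1%g.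
Proof. by apply: (can_inj (gisoK th)); rewrite gisoV !gisoVK. Qed.

End GroupIsoTheory.

Section L2Transport.
Variable R : realType.
Local Notation C := R[i].

Section Push.
Variables (G H : groupType) (th : group_iso G H).

Lemma sqnorm_push (f : G -> C) : sqnorm (f \o giso_inv th) = sqnorm f.
Proof.
rewrite /sqnorm [RHS](reindex_esum [set: H] [set: G] (giso_inv th)) //.
by split=> [//|x y _ _ /(can_inj (gisoVK th))//|y _]; exists (th y) => //;
   rewrite gisoK.
Qed.

Fact l2_push_subproof (u : l2 R G) : val u \o giso_inv th \in @l2_pred R H.
Proof. by apply/asboolP; rewrite sqnorm_push; have /asboolP := valP u. Qed.

Definition l2_push (u : l2 R G) : l2 R H :=
  exist (fun f => f \in @l2_pred R H) _ (l2_push_subproof u).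

Lemma l2norm_push u : l2norm (l2_push u) = l2norm u.
Proof. by rewrite /l2norm sqnorm_push. Qed.

Lemma l2_pushP c u v : l2_push (c *: u + v) = c *: l2_push u + l2_push v.
Proof. exact: val_inj. Qed.

Lemma l2_push_ract g u : l2_push (l2_ract g u) = l2_ract (th g) (l2_push u).
Proof.
apply: val_inj; apply/funext => h /=.
by rewrite giso_invM giso_invV gisoK.
Qed.

Lemma l2_push_lact g u : l2_push (l2_lact g u) = l2_lact (th g) (l2_push u).
Proof.
apply: val_inj; apply/funext => h /=.
by rewrite giso_invM giso_invV gisoK.
Qed.

Lemma l2_push_delta1 : l2_push (l2_delta R 1%g) = l2_delta R 1%g.
Proof.
apply: val_inj; apply/funext => h /=.
by rewrite -[in LHS](giso_inv1 th) (inj_eq (can_inj (gisoVK th))).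
Qed.

End Push.

Section Conjugation.
Variables (G H : groupType) (th : group_iso G H).

Lemma l2_pushK : cancel (l2_push th) (l2_push (giso_sym th)).
Proof.
by move=> u; apply: val_inj; apply/funext => h /=; rewrite gisoK.
Qed.

Lemma l2_pushVK : cancel (l2_push (giso_sym th)) (l2_push th).
Proof.
by move=> u; apply: val_inj; apply/funext => h /=; rewrite gisoVK.
Qed.

Lemma l2_dot_push (u v : l2 R G) :
  l2dot (l2_push th u) (l2_push th v) = l2dot u v.
Proof.
rewrite /l2dot -[RHS](@reindex_sum _ _ _ _ _ th _ (gisoVK th) (gisoK th)).
by [].
Qed.

(** Conjugation by the unitary that relabels the basis along [th]. *)
Definition vN_conj (T : l2 R G -> l2 R G) (u : l2 R H) : l2 R H :=
  l2_push th (T (l2_push (giso_sym th) u)).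

Fact vN_push_subproof (T : vN R G) : vN_conj (val T) \in @vN_pred R H.
Proof.
have /asboolP[lT [K hK] cT] := valP T; apply/asboolP; split.
- by move=> c u v; rewrite /vN_conj l2_pushP lT l2_pushP.
- by exists K => u; rewrite /vN_conj l2norm_push -(l2norm_push (giso_sym th)).
move=> h u; rewrite /vN_conj l2_push_ract cT l2_push_ract /=.
by rewrite gisoVK.
Qed.

Definition vN_push (T : vN R G) : vN R H :=
  exist (fun T => T \in @vN_pred R H) _ (vN_push_subproof T).

Lemma vN_pushP c S T : vN_push (c *: S + T) = c *: vN_push S + vN_push T.
Proof.
by apply: val_inj; apply/funext => u; rewrite /= /vN_conj l2_pushP.
Qed.

Lemma vN_pushD : {morph vN_push : S T / S + T}.
Proof. by move=> S T; have := vN_pushP 1 S T; rewrite !scale1r. Qed.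

Lemma vN_pushM : {morph vN_push : S T / S * T}.
Proof.
by move=> S T; apply: val_inj; apply/funext => u; rewrite /= /vN_conj /= l2_pushK.
Qed.

Lemma vN_push_tr T : vN_tr (vN_push T) = vN_tr T.
Proof.
rewrite /vN_tr /= /vN_conj l2_push_delta1 -[X in l2dot _ X](l2_push_delta1 th).
exact: l2_dot_push.
Qed.

Lemma vN_push_lreg g : vN_push (vN_lreg R g) = vN_lreg R (th g).
Proof.
by apply: val_inj; apply/funext => u; rewrite /= /vN_conj l2_push_lact l2_pushVK.
Qed.

Definition ga_push (a : group_algebra C G) : group_algebra C H :=
  malg_lift (fun g => ga_elt C (th g)) a.

Lemma ga_pushU g : ga_push (ga_elt C g) = ga_elt C (th g).
Proof. exact: malg_liftU. Qed.

Lemma ga_pushP c a b : ga_push (c *: a + b) = c *: ga_push a + ga_push b.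
Proof. by rewrite /ga_push linearP. Qed.

Lemma ga_push0 : ga_push 0 = 0.
Proof. exact: linear0. Qed.

(** This square is what makes extension of scalars from the group algebra to
    the von Neumann algebra compatible with [th]. *)
Lemma vN_push_ga a : vN_push (@ga_vN R G a) = @ga_vN R H (ga_push a).
Proof.
elim/ga_ind: a => [a b c ha hb||g].
- by rewrite ga_vNP vN_pushP ha hb ga_pushP ga_vNP.
- rewrite ga_push0 /ga_vN !linear0; exact: (morphD0 vN_pushD).
by rewrite ga_pushU !ga_vN_elt vN_push_lreg.
Qed.

End Conjugation.

Lemma vN_pushK (G H : groupType) (th : group_iso G H) :
  cancel (vN_push th) (vN_push (giso_sym th)).
Proof.
move=> T; apply: val_inj; apply/funext => u; rewrite /= /vN_conj /= /vN_conj.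
by rewrite l2_pushK (l2_pushVK (giso_sym th)).
Qed.

Lemma vN_pushVK (G H : groupType) (th : group_iso G H) :
  cancel (vN_push (giso_sym th)) (vN_push th).
Proof.
move=> T; apply: val_inj; apply/funext => u; rewrite /= /vN_conj /= /vN_conj.
by rewrite l2_pushVK (l2_pushK (giso_sym th)).
Qed.

End L2Transport.

(** * Invariance of the von Neumann dimension *)

Section DimensionInvariance.
Variable R : realType.

(** A finitely generated projective submodule of [M] presented by the
    idempotent [A] has as image in [N] one presented by the idempotent
    [map_mx rho A], which has the same trace. *)
Lemma vN_dim_semi_le (G H : groupType) (rho : vN R G -> vN R H)
    (rho' : vN R H -> vN R G) (M : lmodType (vN R G)^c)
    (N : lmodType (vN R H)^c) :
  {morph rho : x y / x + y} -> {morph rho : x y / x * y} ->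
  cancel rho rho' -> cancel rho' rho ->
  (forall T, vN_tr (rho T) = vN_tr T) ->
  @semi_iso (vN R G)^c (vN R H)^c rho M N -> (vN_dim M <= vN_dim N)%E.
Proof.
move=> rD rM rK rVK rtr [f [[fD fZ] [g fK gK]]].
have gD : {morph g : x y / x + y} by apply: bij_morphD fD fK gK.
have rVM : {morph rho' : x y / x * y}.
  by move=> x y; apply: (can_inj rK); rewrite rM !rVK.
have rVD : {morph rho' : x y / x + y} := bij_morphD rD rK rVK.
have gZ (a : vN R H) n : g ((a : (vN R H)^c) *: n) = (rho' a : (vN R G)^c) *: g n.
  by apply: (can_inj fK); rewrite fZ !gK rVK.
apply: ge_ereal_sup => _ [d [L [n [A [AA [h [h' hK h'K]] trA]]]] <-].
apply: ereal_sup_ubound; exists d => //.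
(* The image of [L] under [f], written as the preimage under its inverse. *)
pose P : {pred N} := fun m => g m \in L.
have PE x : (x \in P) = (g x \in L) by [].
have PS : submod_closed P.
  split=> [|c x y]; rewrite !PE ?(morphD0 gD) ?rpred0 // gD gZ => hx hy.
  by apply: rpredD => //; apply: rpredZ.
pose K := GRing.isSubmodClosed.Build (vN R H)^c N P PS.
pose L' : submodClosed N := HB.pack P K.
have map_mulmx m p (S T : pzRingType) (s : S -> T)
    (X : 'M[S]_(m, n)) (Y : 'M[S]_(n, p)) :
    {morph s : x y / x + y} -> {morph s : x y / x * y} ->
    map_mx s (X *m Y) = map_mx s X *m map_mx s Y.
  move=> sD sM; apply/matrixP => i j; rewrite !mxE.
  rewrite (big_morph s sD (morphD0 sD)); apply: eq_bigr => k _.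
  by rewrite !mxE sM.
pose A' := map_mx rho A.
have toA (w : 'cV[vN R H]_n) : (w : 'cV[(vN R H)^c]_n) \in mx_image A' ->
    (map_mx rho' w : 'cV[(vN R G)^c]_n) \in mx_image A.
  move=> /asboolP[v ->]; apply/asboolP; exists (map_mx rho' v).
  have eA : A = map_mx rho' A' by apply/matrixP => i j; rewrite !mxE rK.
  by rewrite [in RHS]eA -map_mulmx.
have toA' (w : 'cV[vN R G]_n) : (w : 'cV[(vN R G)^c]_n) \in mx_image A ->
    (map_mx rho w : 'cV[(vN R H)^c]_n) \in mx_image A'.
  move=> /asboolP[v ->]; apply/asboolP; exists (map_mx rho v).
  by rewrite map_mulmx.
pose pull (w : submodule (mx_image A')) : submodule (mx_image A) :=
  exist (fun z => z \in mx_image A) _ (toA (val w) (valP w)).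
have k_sub (w : submodule (mx_image A')) : f (val (h (pull w))) \in L'.
  by rewrite [_ \in _]PE fK; apply: valP.
pose k (w : submodule (mx_image A')) : submodule L' :=
  exist (fun z => z \in L') _ (k_sub w).
have kP : linear k.
  move=> a x y; apply: val_inj => /=.
  rewrite -[in RHS](rVK a) -fZ -fD; congr f.
  have -> : pull (a *: x + y) = (rho' a : (vN R G)^c) *: pull x + pull y.
    apply: val_inj; apply/matrixP => i j /=.
    by rewrite !mxE /= rVD rVM.
  by rewrite linearP.
pose kL := HB.pack_for {linear submodule (mx_image A') -> submodule L'} k
  (GRing.isLinear.Build _ _ _ _ k kP).
exists L', n, A'; split.
- by rewrite -map_mulmx // AA.
- exists kL.
  pose k' (z : submodule L') : submodule (mx_image A') :=
    exist (fun w => w \in mx_image A') _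
      (toA' _ (valP (h' (exist (fun m => m \in L) (g (val z)) (valP z))))).
  exists k' => [w|z]; apply: val_inj => /=.
    have -> : exist _ (g (f (val (h (pull w))))) (valP (k w)) = h (pull w)
        :> submodule L by apply: val_inj; rewrite /= fK.
    by rewrite hK; apply/matrixP => i j; rewrite !mxE rVK.
  have -> : pull (k' z) = h' (exist (fun m => m \in L) (g (val z)) (valP z)).
    by apply: val_inj; apply/matrixP => i j; rewrite !mxE rK.
  by rewrite h'K /= gK.
by rewrite -trA; apply: eq_bigr => i _; rewrite mxE rtr.
Qed.

Lemma vN_dim_semi_eq (G H : groupType) (rho : vN R G -> vN R H)
    (rho' : vN R H -> vN R G) (M : lmodType (vN R G)^c)
    (N : lmodType (vN R H)^c) :
  {morph rho : x y / x + y} -> {morph rho : x y / x * y} ->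
  cancel rho rho' -> cancel rho' rho ->
  (forall T, vN_tr (rho T) = vN_tr T) ->
  @semi_iso (vN R G)^c (vN R H)^c rho M N -> vN_dim M = vN_dim N.
Proof.
move=> rD rM rK rVK rtr MN; apply/eqP; rewrite eq_le; apply/andP; split.
  exact: vN_dim_semi_le rD rM rK rVK rtr MN.
apply: (vN_dim_semi_le (rho := rho') (rho' := rho)) => // [|x y|T|].
- exact: bij_morphD rD rK rVK.
- by apply: (can_inj rK); rewrite rM !rVK.
- by rewrite -rtr rVK.
have [f [[fD fZ] [g fK gK]]] := MN; exists g; split; last by exists f.
split=> [|a n]; first exact: bij_morphD fD fK gK.
by apply: (can_inj fK); rewrite fZ !gK rVK.
Qed.

Lemma vN_dim_semi_iso (G H : groupType) (th : group_iso G H)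
    (M : lmodType (vN R G)^c) (N : lmodType (vN R H)^c) :
  @semi_iso (vN R G)^c (vN R H)^c (vN_push th) M N -> vN_dim M = vN_dim N.
Proof.
apply: vN_dim_semi_eq; [exact: vN_pushD|exact: vN_pushM|
  exact: vN_pushK|exact: vN_pushVK|exact: vN_push_tr].
Qed.

Lemma vN_dim_iso (G : groupType) (M N : lmodType (vN R G)^c) :
  @semi_iso (vN R G)^c (vN R G)^c id M N -> vN_dim M = vN_dim N.
Proof. exact: (@vN_dim_semi_eq G G id id). Qed.

End DimensionInvariance.

(** * Semilinear maps of tensor products *)

Section TensorSemilinear.
Variables (A B A' B' : pzRingType).
Variables (phi : {rmorphism A -> B}) (phi' : {rmorphism A' -> B'}).
Variables (alpha : A -> A') (beta : B -> B').
Hypothesis betaD : {morph beta : x y / x + y}.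
Hypothesis betaM : {morph beta : x y / x * y}.
Hypothesis beta_phi : forall a, beta (phi a) = phi' (alpha a).
Variables (M : lmodType A^c) (M' : lmodType A'^c) (f : M -> M').
Hypothesis fS : @semilinear A^c A'^c alpha M M' f.

Let basis (k : M * B) : {malg int[(M' * B')%type]} := << (f k.1, beta k.2) >>.

Fact tensor_smap_rel z : z \in span (tensor_rel phi (M := M)) ->
  malg_lift basis z \in span (tensor_rel phi' (M := M')).
Proof.
have [fD fZ] := fS; apply: span_map => {}z [[|]|].
- move=> [m [m' [b ->]]]; rewrite !linearB /= !malg_liftU; apply: mem_span.
  by left; left; exists (f m), (f m'), (beta b); rewrite /basis /= fD.
- move=> [m [b [b' ->]]]; rewrite !linearB /= !malg_liftU; apply: mem_span.
  by left; right; exists (f m), (beta b), (beta b'); rewrite /basis /= betaD.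
move=> [m [a [b ->]]]; rewrite !linearB /= !malg_liftU; apply: mem_span.
by right; exists (f m), (alpha a), (beta b); rewrite /basis /= fZ betaM beta_phi.
Qed.

Definition tensor_smap (t : tensor phi M) : tensor phi' M' :=
  quot_smap (span (tensor_rel phi' (M := M'))) (malg_lift basis) t.

Lemma tensor_smapD : {morph tensor_smap : s t / s + t}.
Proof.
have lS := linear_semilinear (malg_lift basis : {linear _ -> _}).
exact: (quot_smap_semilinear lS tensor_smap_rel).1.
Qed.

Lemma tensor_smapE m b : tensor_smap (tens phi m b) = tens phi' (f m) (beta b).
Proof.
rewrite tens.unlock /tensor_smap quot_smapE; last exact: tensor_smap_rel.
  by rewrite malg_liftU.
exact: linearD.
Qed.

Lemma tensor_smap_semilinear :
  @semilinear B^c B'^c beta (tensor phi M) (tensor phi' M') tensor_smap.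
Proof.
split=> [|b t]; first exact: tensor_smapD.
elim/tens_ind: t => [|s t hs ht|t ht|m d].
- by rewrite scaler0 (morphD0 tensor_smapD) scaler0.
- by rewrite scalerDr !tensor_smapD hs ht scalerDr.
- by rewrite scalerN !(morphDN tensor_smapD) ht scalerN.
by rewrite [b *: _]tensor_actE !tensor_smapE [(beta b : B'^c) *: _]tensor_actE betaM.
Qed.

End TensorSemilinear.

Lemma tensor_ext (A B : pzRingType) (phi : {rmorphism A -> B})
    (M : lmodType A^c) (V : zmodType) (f g : tensor phi M -> V) :
  {morph f : x y / x + y} -> {morph g : x y / x + y} ->
  (forall m b, f (tens phi m b) = g (tens phi m b)) -> f =1 g.
Proof.
move=> fD gD fg; elim/tens_ind => [|s t hs ht|t ht|m b].
- by rewrite (morphD0 fD) (morphD0 gD).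
- by rewrite fD gD hs ht.
- by rewrite (morphDN fD) (morphDN gD) ht.
exact: fg.
Qed.

(** * Splitting followed by extension of scalars, as an additive functor *)

Section L2Functor.
Variables (R : realType) (Gam : category) (x : Gam).
Local Notation phi := (@ga_vN R (aut x)).

Definition l2_mod (M : cmodule R Gam) : lmodType (vN R (aut x))^c :=
  tensor phi (splitting M x).

Definition l2_map (M N : cmodule R Gam) (f : cmorphism M N) :
    {linear l2_mod M -> l2_mod N} := @tensor_map _ _ phi _ _ (splitting_map f x).

(** The generators on which the functor is computed; checking an identity on
    them ([l2_ext]) avoids unfolding the quotient and the tensor product. *)
Definition l2_gen (M : cmodule R Gam) (m : M x) (b : vN R (aut x)) : l2_mod M :=
  tens phi (quot_proj (span (@noniso_images R Gam M x)) m : splitting M x) b.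

Lemma l2_mapE (M N : cmodule R Gam) (f : cmorphism M N) m b :
  l2_map f (l2_gen m b) = l2_gen (f x m) b.
Proof.
by rewrite /l2_map /l2_gen /= tensor_mapE /splitting_map /= quot_mapE.
Qed.

Lemma l2_mapD (M N : cmodule R Gam) (f : cmorphism M N) :
  {morph l2_map f : s t / s + t}.
Proof. exact: linearD. Qed.

Lemma l2_genD (M : cmodule R Gam) (m n : M x) b :
  l2_gen (m + n) b = l2_gen m b + l2_gen n b.
Proof.
rewrite /l2_gen -tensDl; congr tens.
exact: (linearD (quot_proj (span (@noniso_images R Gam M x)))).
Qed.

Lemma l2_genB (M : cmodule R Gam) (m n : M x) b :
  l2_gen (m - n) b = l2_gen m b - l2_gen n b.
Proof. exact: (morphDB (fun m n => @l2_genD M m n b)). Qed.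

Lemma l2_ext (M : cmodule R Gam) (V : zmodType) (f g : l2_mod M -> V) :
  {morph f : x y / x + y} -> {morph g : x y / x + y} ->
  (forall m b, f (l2_gen m b) = g (l2_gen m b)) -> f =1 g.
Proof.
move=> fD gD fg; apply: tensor_ext fD gD _ => m b.
by rewrite -(quot_proj_repr m); apply: fg.
Qed.

End L2Functor.

(** On a cycle the term [h n (res_d z)] of the homotopy relation vanishes, so
    there the relation exhibits a boundary; in degree 0 there is no such term
    to begin with. *)
Lemma l2_homotopy (R : realType) (Gam : category) (x : Gam)
    (P Q : resolution R Gam)
    (u : forall n, cmorphism (P n) (Q n))
    (v : forall n, cmorphism (Q n) (P n))
    (h : forall n, cmorphism (P n) (P n.+1)) :
  (forall y m, res_d P 0 y (h 0 y m) = v 0 y (u 0 y m) - m) ->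
  (forall n y m, res_d P n.+1 y (h n.+1 y m) + h n y (res_d P n y m) =
     v n.+1 y (u n.+1 y m) - m) ->
  forall n z, z \in cycles (l2_cpx P x) n ->
  exists y, cpx_d (l2_cpx P x) n y = l2_map x (v n) (l2_map x (u n) z) - z.
Proof.
move=> h0 hS n z hz; exists (l2_map x (h n) z).
case: n z hz => [|n] z hz.
  apply: (l2_ext (f := fun z => l2_map x (res_d P 0) (l2_map x (h 0) z))
    (g := fun z => l2_map x (v 0) (l2_map x (u 0) z) - z)) => [a b|a b|m b].
  - by cbv beta; rewrite !linearD.
  - by cbv beta; rewrite !linearD addrACA.
  by rewrite !l2_mapE h0 l2_genB.
have -> : cpx_d (l2_cpx P x) n.+1 (l2_map x (h n.+1) z) =
    l2_map x (res_d P n.+1) (l2_map x (h n.+1) z) +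
    l2_map x (h n) (l2_map x (res_d P n) z).
  by move/eqP: hz => hz; rewrite [l2_map x (res_d P n) z]hz linear0 addr0.
apply: (l2_ext (f := fun z => l2_map x (res_d P n.+1) (l2_map x (h n.+1) z) +
    l2_map x (h n) (l2_map x (res_d P n) z))
  (g := fun z => l2_map x (v n.+1) (l2_map x (u n.+1) z) - z)) => [a b|a b|m b].
- by cbv beta; rewrite !linearD addrACA.
- by cbv beta; rewrite !linearD addrACA.
by rewrite !l2_mapE -l2_genD hS l2_genB.
Qed.

Section HomotopyInvariance.
Variables (R : realType) (Gam : category) (x : Gam) (P Q : resolution R Gam).
Variables (f : forall n, cmorphism (P n) (Q n)).
Variables (g : forall n, cmorphism (Q n) (P n)).
Variables (s : forall n, cmorphism (P n) (P n.+1)).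
Variables (t : forall n, cmorphism (Q n) (Q n.+1)).
Hypothesis fd : forall n y m,
  f n y (res_d P n y m) = res_d Q n y (f n.+1 y m).
Hypothesis gd : forall n y m,
  g n y (res_d Q n y m) = res_d P n y (g n.+1 y m).
Hypothesis s0 : forall y m, res_d P 0 y (s 0 y m) = g 0 y (f 0 y m) - m.
Hypothesis sS : forall n y m,
  res_d P n.+1 y (s n.+1 y m) + s n y (res_d P n y m) = g n.+1 y (f n.+1 y m) - m.
Hypothesis t0 : forall y m, res_d Q 0 y (t 0 y m) = f 0 y (g 0 y m) - m.
Hypothesis tS : forall n y m,
  res_d Q n.+1 y (t n.+1 y m) + t n y (res_d Q n y m) = f n.+1 y (g n.+1 y m) - m.

Lemma l2_homology_homotopy n :
  @semi_iso (vN R (aut x))^c (vN R (aut x))^c id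
    (homology (l2_cpx P x) n) (homology (l2_cpx Q x) n).
Proof.
have map_d (P' Q' : resolution R Gam) (u : forall n, cmorphism (P' n) (Q' n)) :
    (forall n y m, u n y (res_d P' n y m) = res_d Q' n y (u n.+1 y m)) ->
    forall n z, l2_map x (u n) (cpx_d (l2_cpx P' x) n z) =
      cpx_d (l2_cpx Q' x) n (l2_map x (u n.+1) z).
  move=> ud k; apply: (l2_ext
    (f := fun z => l2_map x (u k) (l2_map x (res_d P' k) z))
    (g := fun z => l2_map x (res_d Q' k) (l2_map x (u k.+1) z))) => [a b|a b|m b].
  - by cbv beta; rewrite !linearD.
  - by cbv beta; rewrite !linearD.
  by rewrite !l2_mapE ud.
apply: (@homology_semi_iso _ _ id (l2_cpx P x) (l2_cpx Q x)
  (fun k => l2_map x (f k)) (fun k => l2_map x (g k))).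
- by move=> k; apply: linear_semilinear.
- by move=> k; apply: linearD.
- exact: map_d.
- exact: map_d.
- exact: l2_homotopy.
- exact: l2_homotopy.
Qed.

End HomotopyInvariance.

(** * Projective modules over a category *)

Section DirectSumUniversal.
Variables (A : pzRingType) (I : Type) (M : I -> lmodType A).

(** The index type has no decidable equality, hence the classical test and the
    transport of [a] along the equality it returns. *)
Definition dprod_inj i (a : M i) : dprod M := fun j =>
  match pselect (i = j) with left e => ecast j (M j) e a | right _ => 0 end.

Lemma dprod_inj_eq i (a : M i) : dprod_inj a i = a.
Proof.
by rewrite /dprod_inj; case: pselect => // e; rewrite (Prop_irrelevance e erefl).
Qed.

Lemma dprod_inj_neq i (a : M i) j : i <> j -> dprod_inj a j = 0.
Proof. by rewrite /dprod_inj; case: pselect. Qed.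

Fact dsum_inj_subproof i (a : M i) : dprod_inj a \in @dsum_pred A I M.
Proof.
apply/asboolP; apply: (@sub_finite_set _ _ [set i]); last exact: finite_set1.
move=> j /= /eqP; case: (pselect (i = j)) => [/esym//|ij].
by rewrite dprod_inj_neq.
Qed.

Definition dsum_inj i (a : M i) : dsum M :=
  exist (fun f => f \in @dsum_pred A I M) _ (dsum_inj_subproof a).

Lemma dsum_injP i : linear (@dsum_inj i).
Proof.
move=> c a b; apply: val_inj; apply: functional_extensionality_dep => j /=.
rewrite -[RHS]/(c *: dprod_inj a j + dprod_inj b j).
case: (pselect (i = j)) => [<-|ij]; first by rewrite !dprod_inj_eq.
by rewrite !dprod_inj_neq // scaler0 addr0.
Qed.

Lemma dsum_dec (m : dsum M) (D : {fset {classic I}}) :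
  (forall i, val m i != 0 -> (i : {classic I}) \in D) ->
  m = \sum_(i <- D) dsum_inj (val m (i : {classic I})).
Proof.
move=> mD; apply: val_inj; apply: functional_extensionality_dep => j.
pose ev (n : dsum M) : M j := val n j.
have evD : {morph ev : x y / x + y} by [].
rewrite -[LHS]/(ev m) -[RHS]/(ev _) (big_morph ev evD erefl).
have [jD|jD] := boolP ((j : {classic I}) \in D).
  rewrite (big_fsetD1 (j : {classic I})) //= [X in _ = X + _]dprod_inj_eq.
  rewrite big1_fset ?addr0 // => i; rewrite !inE => /andP[/eqP ij _] _.
  exact: dprod_inj_neq.
rewrite big1_fset => [|i iD _].
  by apply/eqP; apply: contraNT jD => mj; apply: mD.
by apply: dprod_inj_neq => ij; move: jD; rewrite -ij iD.
Qed.

Lemma dsum_ext (V : lmodType A) (f g : {linear dsum M -> V}) :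
  (forall i (a : M i), f (dsum_inj a) = g (dsum_inj a)) -> f =1 g.
Proof.
move=> fg m; have /asboolP mfin := valP m.
rewrite (@dsum_dec m (fset_set ([set i | val m i != 0] : set {classic I}))).
  by rewrite !linear_sum; apply: eq_bigr => i _; apply: fg.
by move=> i mi; rewrite in_fset_set // inE.
Qed.

Section Lift.
Variables (V : lmodType A) (f : forall i, {linear M i -> V}).

Definition dsum_lift (m : dsum M) : V :=
  \sum_(i \in [set: {classic I}]) f (i : {classic I}) (val m (i : {classic I})).

Lemma dsum_liftE (m : dsum M) (D : {fset {classic I}}) :
  (forall i, val m i != 0 -> (i : {classic I}) \in D) ->
  dsum_lift m = \sum_(i <- D) f (i : {classic I}) (val m (i : {classic I})).
Proof.
move=> mD; rewrite /dsum_lift -(fsbig_widen [set` D]) //; last first.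
  move=> i [_ iD] /=; have [->|mi] := eqVneq (val m i) 0.
    exact: linear0.
  by case: iD; exact: (mD _ mi).
by rewrite -fsbig_seq.
Qed.

Fact dsum_lift_is_linear : linear dsum_lift.
Proof.
move=> c m n; have /asboolP mfin := valP m; have /asboolP nfin := valP n.
pose Dm := fset_set ([set i | val m i != 0] : set {classic I}).
pose Dn := fset_set ([set i | val n i != 0] : set {classic I}).
have mD i : val m i != 0 -> (i : {classic I}) \in (Dm `|` Dn)%fset.
  by move=> mi; rewrite in_fsetU /Dm in_fset_set // mem_set.
have nD i : val n i != 0 -> (i : {classic I}) \in (Dm `|` Dn)%fset.
  by move=> ni; rewrite in_fsetU orbC /Dn in_fset_set // mem_set.
rewrite (dsum_liftE mD) (dsum_liftE nD) (@dsum_liftE _ (Dm `|` Dn)%fset).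
  rewrite scaler_sumr -big_split /=; apply: eq_bigr => i _.
  by rewrite -linearP.
move=> i; rewrite -[val (c *: m + n) i]/(c *: val m i + val n i) => mni.
have [mi|mi] := eqVneq (val m i) 0; last exact: mD.
by apply: nD; move: mni; rewrite mi scaler0 add0r.
Qed.

HB.instance Definition _ := GRing.isLinear.Build A (dsum M) V *:%R
  dsum_lift dsum_lift_is_linear.

Lemma dsum_lift_inj i (a : M i) : dsum_lift (dsum_inj a) = f i a.
Proof.
rewrite (@dsum_liftE _ [fset (i : {classic I})]%fset) => [|j].
  by rewrite big_seq_fset1 /= dprod_inj_eq.
rewrite inE; apply: contra_neqT => /eqP ji.
by apply: dprod_inj_neq => ij; apply: ji.
Qed.

End Lift.
End DirectSumUniversal.

Section ModuleMorphisms.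
Variables (R : realType) (Gam : category).
Local Notation cmodule := (cmodule R Gam).

Definition cmor_id (M : cmodule) : cmorphism M M :=
  @CMorphism R Gam M M (fun x => idfun) (fun _ _ _ _ => erefl).

Section Comp.
Variables (M N P : cmodule) (g : cmorphism N P) (f : cmorphism M N).

Fact cmor_comp_nat x y (u : hom x y) m :
  (g x \o f x) (cm_map M u m) = cm_map P u ((g y \o f y) m).
Proof. by rewrite /= !cmor_nat. Qed.

Definition cmor_comp : cmorphism M P :=
  @CMorphism R Gam M P (fun x => g x \o f x) cmor_comp_nat.

End Comp.

Section Sub.
Variables (M N : cmodule) (f g : cmorphism M N).

Fact cmor_sub_nat x y (u : hom x y) m :
  (f x \- g x) (cm_map M u m) = cm_map N u ((f y \- g y) m).
Proof. by rewrite /= !cmor_nat linearB. Qed.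

Definition cmor_sub : cmorphism M N :=
  @CMorphism R Gam M N (fun x => f x \- g x) cmor_sub_nat.

End Sub.

Section Yoneda.
Variables (M : cmodule) (x : Gam) (m : M x).

Definition yoneda_map y : {linear representable R x y -> M y} :=
  malg_lift (fun u : {classic hom y x} => cm_map M (u : hom y x) m).

Fact yoneda_nat y z (u : hom y z) a :
  yoneda_map y (cm_map (representable R x) u a) = cm_map M u (yoneda_map z a).
Proof.
elim/malg_ind: a => [a b c ha hb||v]; rewrite ?linear0 //.
  by rewrite !linearP ha hb.
by rewrite /= /rep_map /= !malg_liftU cm_comp.
Qed.

Definition yoneda : cmorphism (representable R x) M := CMorphism yoneda_nat.

Lemma yonedaU y (u : hom y x) :
  yoneda y << (u : {classic hom y x}) >> = cm_map M u m.
Proof. by rewrite /yoneda /= /yoneda_map /= malg_liftU. Qed.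

End Yoneda.

Section Copair.
Variables (I : Type) (N : I -> cmodule) (M : cmodule).
Variable f : forall i, cmorphism (N i) M.

Lemma dsum_cmap_inj i y z (u : hom y z) (a : N i z) :
  cm_map (dsum_cmodule N) u (dsum_inj (M := fun i => N i z) a) =
  dsum_inj (M := fun i => N i y) (cm_map (N i) u a).
Proof.
apply: val_inj; apply: functional_extensionality_dep => j /=.
case: (pselect (i = j)) => [<-|ij]; first by rewrite !dprod_inj_eq.
by rewrite !dprod_inj_neq // linear0.
Qed.

Definition copair_map y : {linear dsum_cmodule N y -> M y} :=
  dsum_lift (fun i => f i y).

Fact copair_nat y z (u : hom y z) a :
  copair_map y (cm_map (dsum_cmodule N) u a) = cm_map M u (copair_map z a).
Proof.
apply: (@dsum_ext _ _ _ _ (copair_map y \o cm_map (dsum_cmodule N) u)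
  (cm_map M u \o copair_map z)) => i b.
rewrite [LHS](congr1 (copair_map y) (dsum_cmap_inj u b)).
by rewrite /copair_map /= !dsum_lift_inj cmor_nat.
Qed.

Definition copair : cmorphism (dsum_cmodule N) M := CMorphism copair_nat.

Lemma copair_inj i y (a : N i y) :
  copair y (dsum_inj (M := fun i => N i y) a) = f i y a.
Proof. exact: (dsum_lift_inj (fun i => f i y)). Qed.

End Copair.

(** A representable is free on the identity: lift [k] at the images of the
    identities, extend by Yoneda and the universal property of the sum, and
    restrict to the summand.  The hypothesis asks that the image of [k], rather
    than all of [N], be hit by [d]; exactness of a resolution provides just
    that, without naming kernels. *)
Lemma projective_lift (P M N : cmodule) (d : cmorphism M N) (k : cmorphism P N) :
  projective P -> (forall x p, exists m, d x m = k x p) ->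
  exists h : cmorphism P M, forall x p, d x (h x p) = k x p.
Proof.
move=> [I [x [s [r rs]]]] kd.
pose gen i : dsum_cmodule (fun i => representable R (x i)) (x i) :=
  dsum_inj (M := fun j => representable R (x j) (x i))
  (<< (idm (x i) : {classic hom (x i) (x i)}) >> : representable R (x i) (x i)).
pose m i : M (x i) := sval (cid (kd (x i) (r (x i) (gen i)))).
have hm i : d (x i) (m i) = k (x i) (r (x i) (gen i)) by rewrite /m; case: cid.
pose h' := copair (fun i => yoneda (m i)).
exists (cmor_comp h' s) => y p; rewrite /= -[in RHS](rs y p).
move: (s y p) => q.
apply: (@dsum_ext _ _ _ _ (d y \o h' y) (k y \o r y)) => {q}i a /=.
rewrite [h' y _]copair_inj.
pose inj_lin := HB.pack_for {linear representable R (x i) y -> dsum _}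
  (@dsum_inj _ _ (fun i => representable R (x i) y) i)
  (GRing.isLinear.Build _ _ _ _ _
    (@dsum_injP _ _ (fun i => representable R (x i) y) i)).
apply: (@malg_lin_ext _ _ _ (d y \o yoneda (m i) y) (k y \o r y \o inj_lin)) => u /=.
rewrite [yoneda _ _ _]yonedaU cmor_nat hm.
rewrite -!cmor_nat [cm_map _ u _]dsum_cmap_inj /= /rep_map /= malg_liftU.
by rewrite comp1m.
Qed.

End ModuleMorphisms.

(** * Comparison of projective resolutions *)

(** Both chain maps and homotopies are built one degree at a time, where the
    next component exists only if the current one satisfies the invariant
    [good]. *)
Lemma dependent_choice_nat (T : nat -> Type) (good : forall n, T n -> Prop)
    (rel : forall n, T n -> T n.+1 -> Prop) (base : T 0%N -> Prop) :
  (exists t, base t /\ good 0%N t) ->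
  (forall n t, good n t -> exists t', rel n t t' /\ good n.+1 t') ->
  exists t : forall n, T n, base (t 0%N) /\ forall n, rel n (t n) (t n.+1).
Proof.
move=> /cid[t0 [bt0 gt0]] step.
pose S n := {t : T n | good n t}.
pose next n (s : S n) : S n.+1 :=
  exist _ (sval (cid (step n (sval s) (svalP s))))
    (svalP (cid (step n (sval s) (svalP s)))).2.
pose s := nat_rect S (exist _ t0 gt0) next.
exists (fun n => sval (s n)); split=> // n.
exact: (svalP (cid (step n (sval (s n)) (svalP (s n))))).1.
Qed.

Section ComparisonOfResolutions.
Variables (R : realType) (Gam : category).

Lemma res_dd (P : resolution R Gam) n x m : res_d P n x (res_d P n.+1 x m) = 0.
Proof. by apply/res_exactS; exists m. Qed.

Definition chain_map (P Q : resolution R Gam)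
    (f : forall n, cmorphism (P n) (Q n)) : Prop :=
  (forall x m, res_aug Q x (f 0%N x m) = res_aug P x m) /\
  forall n x m, f n x (res_d P n x m) = res_d Q n x (f n.+1 x m).

(** The invariant is that [f n] sends boundaries to boundaries, which is what
    lifting [f n \o d] along [d] requires. *)
Lemma chain_map_exists (P Q : resolution R Gam) :
  exists f : forall n, cmorphism (P n) (Q n), chain_map f.
Proof.
pose good n (f : cmorphism (P n) (Q n)) := forall x p,
  exists m, res_d Q n x m = f x (res_d P n x p).
pose rel n (f : cmorphism (P n) (Q n)) (f' : cmorphism (P n.+1) (Q n.+1)) :=
  forall x m, f x (res_d P n x m) = res_d Q n x (f' x m).
pose base (f : cmorphism (P 0%N) (Q 0%N)) :=
  forall x m, res_aug Q x (f x m) = res_aug P x m.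
apply: (@dependent_choice_nat _ good rel base) => [|n f fgood].
  have [|f fP] := @projective_lift _ _ _ _ _ (res_aug Q) (res_aug P) (res_proj P 0).
    by move=> x p; apply: res_aug_surj.
  exists f; split=> // x p; apply/res_exact0; rewrite fP.
  by apply/res_exact0; exists p.
have [|f' f'P] := @projective_lift _ _ _ _ _ (res_d Q n) (cmor_comp f (res_d P n))
    (res_proj P n.+1); first exact: fgood.
exists f'; split=> [x m|x p]; first by rewrite f'P.
by apply/res_exactS; rewrite f'P /= res_dd linear0.
Qed.

(** The invariant says that [k (n+1) - s n \o d] takes values in cycles, with
    the differential already pushed through [k]. *)
Lemma null_homotopy_exists (P : resolution R Gam)
    (k : forall n, cmorphism (P n) (P n)) :
  (forall x m, res_aug P x (k 0%N x m) = 0) ->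
  (forall n x m, k n x (res_d P n x m) = res_d P n x (k n.+1 x m)) ->
  exists s : forall n, cmorphism (P n) (P n.+1),
    (forall x m, res_d P 0 x (s 0%N x m) = k 0%N x m) /\
    forall n x m,
      res_d P n.+1 x (s n.+1 x m) + s n x (res_d P n x m) = k n.+1 x m.
Proof.
move=> k0 kd.
pose good n (s : cmorphism (P n) (P n.+1)) := forall x p,
  k n x (res_d P n x p) = res_d P n x (s x (res_d P n x p)).
pose rel n (s : cmorphism (P n) (P n.+1)) (s' : cmorphism (P n.+1) (P n.+2)) :=
  forall x m, res_d P n.+1 x (s' x m) + s x (res_d P n x m) = k n.+1 x m.
pose base (s : cmorphism (P 0%N) (P 1%N)) :=
  forall x m, res_d P 0 x (s x m) = k 0%N x m.
apply: (@dependent_choice_nat _ good rel base) => [|n s sgood].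
  have [|s sP] := @projective_lift _ _ _ _ _ (res_d P 0) (k 0%N) (res_proj P 0).
    by move=> x p; apply/res_exact0.
  by exists s; split=> // x p; rewrite sP.
have [|s' s'P] := @projective_lift _ _ _ _ _ (res_d P n.+1)
    (cmor_sub (k n.+1) (cmor_comp s (res_d P n))) (res_proj P n.+1).
  by move=> x p; apply/res_exactS; rewrite /= linearB -kd sgood subrr.
exists s'; split=> [x m|x p]; first by rewrite s'P /= subrK.
by rewrite s'P /= res_dd linear0 subr0.
Qed.

Lemma chain_map_homotopy (P Q : resolution R Gam)
    (f : forall n, cmorphism (P n) (Q n)) (g : forall n, cmorphism (Q n) (P n)) :
  chain_map f -> chain_map g ->
  exists s : forall n, cmorphism (P n) (P n.+1),
    (forall x m, res_d P 0 x (s 0%N x m) = g 0%N x (f 0%N x m) - m) /\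
    forall n x m, res_d P n.+1 x (s n.+1 x m) + s n x (res_d P n x m) =
      g n.+1 x (f n.+1 x m) - m.
Proof.
move=> [f0 fd] [g0 gd].
apply: (@null_homotopy_exists P
  (fun n => cmor_sub (cmor_comp (g n) (f n)) (cmor_id (P n)))) => [x m|n x m] /=.
  by rewrite linearB g0 f0 subrr.
by rewrite fd gd linearB.
Qed.

Lemma l2_homology_resolution (P Q : resolution R Gam) (x : Gam) n :
  @semi_iso (vN R (aut x))^c (vN R (aut x))^c id
    (homology (l2_cpx P x) n) (homology (l2_cpx Q x) n).
Proof.
have [f fP] := chain_map_exists P Q; have [g gP] := chain_map_exists Q P.
have [s [s0 sS]] := chain_map_homotopy fP gP.
have [t [t0 tS]] := chain_map_homotopy gP fP.
exact: (l2_homology_homotopy x fP.2 gP.2 s0 sS t0 tS).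
Qed.

End ComparisonOfResolutions.

(** * Equivalences of categories *)

Section IsoCancellation.
Variable Gam : category.
Implicit Types x y z : Gam.

Lemma is_iso_cancel_l x y z (v : hom y z) (u : hom x y) :
  is_iso v -> is_iso (compm v u) -> is_iso u.
Proof.
move=> [v' [v'v vv']] vu.
have -> : u = compm v' (compm v u) by rewrite compmA v'v comp1m.
by apply: is_iso_comp => //; exists v.
Qed.

Lemma is_iso_cancel_r x y z (v : hom y z) (u : hom x y) :
  is_iso u -> is_iso (compm v u) -> is_iso v.
Proof.
move=> [u' [u'u uu']] vu.
have -> : v = compm (compm v u) u' by rewrite -compmA uu' compm1.
by apply: is_iso_comp => //; exists u.
Qed.

Lemma iso_cancel_l x y z (v : hom y z) (u u' : hom x y) :
  is_iso v -> compm v u = compm v u' -> u = u'.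
Proof.
move=> [v' [v'v vv']] e.
by rewrite -(comp1m u) -v'v -compmA e compmA v'v comp1m.
Qed.

Lemma iso_cancel_r x y z (v v' : hom y z) (u : hom x y) :
  is_iso u -> compm v u = compm v' u -> v = v'.
Proof.
move=> [u' [u'u uu']] e.
by rewrite -(compm1 v) -uu' compmA e -compmA uu' compm1.
Qed.

End IsoCancellation.

Section EquivalenceFacts.
Variables (Gam1 Gam2 : category) (F : functor Gam1 Gam2).

Lemma is_iso_fmap x y (u : hom x y) : is_iso u -> is_iso (fmap F u).
Proof.
move=> [v [vu uv]]; exists (fmap F v).
by rewrite -!fmap_comp vu uv !fmap_id.
Qed.

Lemma comp_iso_id_faithful (G : functor Gam2 Gam1) : comp_iso_id F G ->
  forall x y (u v : hom x y), fmap F u = fmap F v -> u = v.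
Proof.
move=> [eta [eta_iso eta_nat]] x y u v uv.
by apply: (iso_cancel_l (eta_iso y)); rewrite !eta_nat uv.
Qed.

Lemma comp_iso_id_reflects_iso (G : functor Gam2 Gam1) : comp_iso_id F G ->
  forall x y (u : hom x y), is_iso (fmap F u) -> is_iso u.
Proof.
move=> [eta [eta_iso eta_nat]] x y u [v [vu uv]].
apply: (is_iso_cancel_l (eta_iso y)); rewrite eta_nat; apply: is_iso_comp => //.
by exists (fmap G v); rewrite -!fmap_comp vu uv !fmap_id.
Qed.

End EquivalenceFacts.

Lemma equivalence_full (Gam1 Gam2 : category) (F : functor Gam1 Gam2)
    (G : functor Gam2 Gam1) : comp_iso_id F G -> comp_iso_id G F ->
  forall x y (v : hom (F x) (F y)), exists u : hom x y, fmap F u = v.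
Proof.
move=> [eta [eta_iso eta_nat]] GF x y v.
have [e [ee' e'e]] := eta_iso y.
exists (compm e (compm (fmap G v) (eta x))).
apply: (comp_iso_id_faithful GF); apply: (iso_cancel_r (eta_iso x)).
by rewrite -eta_nat compmA e'e comp1m.
Qed.

Lemma equivalence_sym (Gam1 Gam2 : category) :
  equivalent Gam1 Gam2 -> equivalent Gam2 Gam1.
Proof. by move=> [F [G [FG GF]]]; exists G, F. Qed.

Lemma directly_finite_equivalence (Gam1 Gam2 : category) (F : functor Gam1 Gam2) :
  is_equivalence F -> directly_finite Gam2 -> directly_finite Gam1.
Proof.
move=> [G [FG _]] df x y u v vu; apply: (comp_iso_id_faithful FG).
by rewrite fmap_comp fmap_id; apply: df; rewrite -fmap_comp vu fmap_id.
Qed.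

(** * Restriction along an equivalence *)

Section Restriction.
Variables (R : realType) (Gam1 Gam2 : category) (F : functor Gam1 Gam2).

Section Module.
Variable M : cmodule R Gam2.

Fact restrict_id x m : cm_map M (fmap F (idm x)) m = m.
Proof. by rewrite fmap_id cm_id. Qed.

Fact restrict_comp x y z (v : hom y z) (u : hom x y) m :
  cm_map M (fmap F (compm v u)) m =
  cm_map M (fmap F u) (cm_map M (fmap F v) m).
Proof. by rewrite fmap_comp cm_comp. Qed.

Definition restrict : cmodule R Gam1 :=
  @CModule R Gam1 (fun x => M (F x)) (fun x y u => cm_map M (fmap F u))
    restrict_id restrict_comp.

End Module.

Definition restrict_mor (M N : cmodule R Gam2) (f : cmorphism M N) :
    cmorphism (restrict M) (restrict N) :=
  @CMorphism R Gam1 (restrict M) (restrict N) (fun x => f (F x))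
    (fun x y u m => cmor_nat f (fmap F u) m).

Definition restrict_const :
    cmorphism (restrict (const_cmodule R Gam2)) (const_cmodule R Gam1) :=
  @CMorphism R Gam1 (restrict (const_cmodule R Gam2)) (const_cmodule R Gam1)
    (fun x => idfun) (fun _ _ _ _ => erefl).

Variable G : functor Gam2 Gam1.
Hypotheses (FG : comp_iso_id F G) (GF : comp_iso_id G F).

(** The map f |-> G f \o eta_x has the retraction
    h |-> eps_y^-1 \o F (h \o eta_x^-1) \o eps_(F x).  The expected inverse
    h |-> eps_y^-1 \o F h would need the triangle identities; correcting it by
    eta and eps makes naturality suffice. *)
Lemma restrict_representable (y : Gam2) :
  direct_summand (restrict (representable R y)) (representable R (G y)).
Proof.
have [eta [eta_iso eta_nat]] := FG; have [eps [eps_iso eps_nat]] := GF.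
pose eps' y := sval (cid (eps_iso y)).
have eps'K z : compm (eps' z) (eps z) = idm z by rewrite /eps'; case: cid => ? [].
pose eta' x := sval (cid (eta_iso x)).
have eta'K x : compm (eta' x) (eta x) = idm x by rewrite /eta'; case: cid => ? [].
have etaK x : compm (eta x) (eta' x) = idm (G (F x)).
  by rewrite /eta'; case: cid => ? [].
have eta'_nat x z (u : hom x z) :
    compm u (eta' x) = compm (eta' z) (fmap G (fmap F u)).
  apply: (iso_cancel_l (eta_iso z)); apply: (iso_cancel_r (eta_iso x)).
  by rewrite -!compmA eta'K compm1 -eta_nat !compmA etaK comp1m.
pose sf x (f : hom (F x) y) : hom x (G y) := compm (fmap G f) (eta x).
pose rf x (h : hom x (G y)) : hom (F x) y :=
  compm (eps' y) (compm (fmap F (compm h (eta' x))) (eps (F x))).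
have sf_nat x z (u : hom x z) f :
    sf x (compm f (fmap F u)) = compm (sf z f) u.
  by rewrite /sf fmap_comp -!compmA eta_nat.
have rf_nat x z (u : hom x z) h :
    rf x (compm h u) = compm (rf z h) (fmap F u).
  rewrite /rf -!compmA; congr compm.
  by rewrite eta'_nat !fmap_comp -!compmA eps_nat.
have rsf x f : rf x (sf x f) = f.
  by rewrite /rf /sf -!compmA etaK compm1 -eps_nat compmA eps'K comp1m.
pose s_map x : {linear restrict (representable R y) x -> representable R (G y) x} :=
  malg_lift (fun f : {classic hom (F x) y} =>
    << (sf x f : {classic hom x (G y)}) >> : representable R (G y) x).
pose r_map x : {linear representable R (G y) x -> restrict (representable R y) x} :=
  malg_lift (fun h : {classic hom x (G y)} =>
    << (rf x h : {classic hom (F x) y}) >> : restrict (representable R y) x).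
have s_nat x z (u : hom x z) m :
    s_map x (cm_map (restrict (representable R y)) u m) =
    cm_map (representable R (G y)) u (s_map z m).
  elim/malg_ind: m => [a b c ha hb||f]; rewrite ?linear0 //.
    by rewrite !linearP ha hb.
  by rewrite /s_map /= /rep_map /= !malg_liftU sf_nat.
have r_nat x z (u : hom x z) m :
    r_map x (cm_map (representable R (G y)) u m) =
    cm_map (restrict (representable R y)) u (r_map z m).
  elim/malg_ind: m => [a b c ha hb||f]; rewrite ?linear0 //.
    by rewrite !linearP ha hb.
  by rewrite /r_map /= /rep_map /= !malg_liftU rf_nat.
exists (CMorphism s_nat), (CMorphism r_nat) => x m.
rewrite -[LHS]/(r_map x (s_map x m)).
elim/malg_ind: m => [a b c ha hb||f]; rewrite ?linear0 //.
  by rewrite !linearP ha hb.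
by rewrite /r_map /s_map /= !malg_liftU rsf.
Qed.

Lemma restrict_projective (P : cmodule R Gam2) :
  projective P -> projective (restrict P).
Proof.
move=> [I [y [s [r rs]]]].
exists I, (fun i => G (y i)).
pose s_i i := sval (cid (restrict_representable (y i))).
pose r_i i := sval (cid (svalP (cid (restrict_representable (y i))))).
have rs_i i x m : r_i i x (s_i i x m) = m.
  exact: (svalP (cid (svalP (cid (restrict_representable (y i)))))).
pose Q := dsum_cmodule (fun i => representable R (y i)).
pose Q' := dsum_cmodule (fun i => representable R (G (y i))).
pose s_map x : {linear restrict Q x -> Q' x} := dsum_map (fun i => s_i i x).
pose r_map x : {linear Q' x -> restrict Q x} := dsum_map (fun i => r_i i x).
have s_nat x z (u : hom x z) m :
    s_map x (cm_map (restrict Q) u m) = cm_map Q' u (s_map z m).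
  apply: val_inj; apply: functional_extensionality_dep => i.
  exact: (cmor_nat (s_i i) u).
have r_nat x z (u : hom x z) m :
    r_map x (cm_map Q' u m) = cm_map (restrict Q) u (r_map z m).
  apply: val_inj; apply: functional_extensionality_dep => i.
  exact: (cmor_nat (r_i i) u).
exists (cmor_comp (CMorphism s_nat) (restrict_mor s)).
exists (cmor_comp (restrict_mor r) (CMorphism r_nat)) => x m.
rewrite /= -[RHS]rs; congr (r _ _).
by apply: val_inj; apply: functional_extensionality_dep => i; apply: rs_i.
Qed.

Definition restrict_resolution (P : resolution R Gam2) : resolution R Gam1 :=
  @Resolution R Gam1 (fun n => restrict (P n)) (fun n => restrict_mor (res_d P n))
    (cmor_comp restrict_const (restrict_mor (res_aug P)))
    (fun n => restrict_projective (res_proj P n))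
    (fun x => @res_aug_surj R Gam2 P (F x))
    (fun x => @res_exact0 R Gam2 P (F x))
    (fun n x => @res_exactS R Gam2 P n (F x)).

Section Transport.
Variables (x : Gam1) (y : Gam2) (w : hom y (F x)) (w' : hom (F x) y).
Hypotheses (w'w : compm w' w = idm y) (ww' : compm w w' = idm (F x)).

Let w_iso : is_iso w. Proof. by exists w'. Qed.
Let w'_iso : is_iso w'. Proof. by exists w. Qed.

(** Conjugation by [w], after [F]. *)
Definition aut_transport (u : aut x) : aut y :=
  exist _ (compm w' (compm (fmap F (sval u)) w))
    (is_iso_comp w'_iso (is_iso_comp (is_iso_fmap F (svalP u)) w_iso)).

Lemma aut_transportE u :
  compm w (sval (aut_transport u)) = compm (fmap F (sval u)) w.
Proof. by rewrite /= compmA ww' comp1m. Qed.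

Lemma aut_transport_surj v : exists u, aut_transport u = v.
Proof.
have [u uE] := equivalence_full FG GF (compm w (compm (sval v) w')).
have u_iso : is_iso u.
  apply: (comp_iso_id_reflects_iso FG); rewrite uE.
  by apply: is_iso_comp => //; apply: is_iso_comp => //; apply: svalP.
exists (exist _ u u_iso); apply: aut_inj => /=.
by rewrite uE -!compmA w'w compm1 compmA w'w comp1m.
Qed.

Lemma aut_transport_inj : injective aut_transport.
Proof.
move=> u v uv; apply: aut_inj; apply: (comp_iso_id_faithful FG).
by apply: (iso_cancel_r w_iso); rewrite -!aut_transportE uv.
Qed.

Lemma aut_transportM : {morph aut_transport : u v / (u * v)%g}.
Proof.
move=> u v; apply: aut_inj; apply: (iso_cancel_l w_iso).
rewrite aut_transportE fmap_comp /= [RHS]compmA.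
by rewrite !compmA ww' comp1m -!compmA (compmA w w') ww' comp1m.
Qed.

Definition aut_inv_transport v : aut x := sval (cid (aut_transport_surj v)).

Lemma aut_inv_transportK : cancel aut_inv_transport aut_transport.
Proof. by move=> v; rewrite /aut_inv_transport; case: cid. Qed.

Lemma aut_transportK : cancel aut_transport aut_inv_transport.
Proof. by move=> u; apply: aut_transport_inj; rewrite aut_inv_transportK. Qed.

Definition aut_iso : group_iso (aut x) (aut y) :=
  GroupIso aut_transportK aut_inv_transportK aut_transportM.

(** In this section [M w], which identifies [M (F x)] with [M y], is carried
    through splitting and extension of scalars, together with its inverse. *)
Section Module.
Variable M : cmodule R Gam2.
Local Notation rM := (restrict M).
Local Notation relx := (span (@noniso_images R Gam1 rM x)).
Local Notation rely := (span (@noniso_images R Gam2 M y)).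

Let fwd (m : at_obj rM x) : at_obj M y := cm_map M w m.
Let bwd (m : at_obj M y) : at_obj rM x := cm_map M w' m.

Let fwd_semilinear : @semilinear (group_algebra R[i] (aut x))^c
  (group_algebra R[i] (aut y))^c (ga_push aut_iso) (at_obj rM x) (at_obj M y) fwd.
Proof.
split=> [m n|a m]; first exact: (linearD (cm_map M w)).
rewrite -[a *: m]/(at_act a m) -[RHS]/(at_act (ga_push aut_iso a) (fwd m)).
rewrite /fwd; elim/ga_ind: a => [a b c ha hb||u].
- by rewrite ga_pushP !at_actDl !at_actZl [LHS](linearP (cm_map M w)) ha hb.
- by rewrite ga_push0 !at_act0 [LHS](linear0 (cm_map M w)).
rewrite ga_pushU !at_actU [LHS](_ : _ = cm_map M w (cm_map M (fmap F (sval u)) m)) //.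
by rewrite -!cm_comp aut_transportE.
Qed.

Let bwd_semilinear : @semilinear (group_algebra R[i] (aut y))^c
  (group_algebra R[i] (aut x))^c (ga_push (giso_sym aut_iso))
  (at_obj M y) (at_obj rM x) bwd.
Proof.
split=> [m n|a m]; first exact: (linearD (cm_map M w')).
rewrite -[a *: m]/(at_act a m).
rewrite -[RHS]/(at_act (ga_push (giso_sym aut_iso) a) (bwd m)).
rewrite /bwd; elim/ga_ind: a => [a b c ha hb||v].
- by rewrite ga_pushP !at_actDl !at_actZl [LHS](linearP (cm_map M w')) ha hb.
- by rewrite ga_push0 !at_act0 [LHS](linear0 (cm_map M w')).
rewrite ga_pushU !at_actU.
rewrite [RHS](_ : _ =
  cm_map M (fmap F (sval (aut_inv_transport v))) (cm_map M w' m)) //.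
have e : compm (sval v) w' = compm w' (fmap F (sval (aut_inv_transport v))).
  by rewrite -{1}(aut_inv_transportK v) /= -!compmA ww' compm1.
by rewrite -!cm_comp e.
Qed.

(** [F] reflects isomorphisms, so it sends the morphisms defining the splitting
    over [Gam1] to morphisms defining it over [Gam2]; conversely, in [bwd_rel],
    every morphism out of [F x] is, up to an isomorphism [eps z] of its target,
    in the image of the full functor [F]. *)
Let fwd_rel m : m \in relx -> fwd m \in rely.
Proof.
apply: (span_semilinear fwd_semilinear) => {}m [z [u [nu [n ->]]]].
apply: mem_span; exists (F z), (compm (fmap F u) w); split; last first.
  by exists n; rewrite cm_comp.
move=> uw; apply: nu; apply: (comp_iso_id_reflects_iso FG).
exact: (is_iso_cancel_r w_iso uw).
Qed.

Let bwd_rel m : m \in rely -> bwd m \in relx.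
Proof.
apply: (span_semilinear bwd_semilinear) => {}m [z [v [nv [n ->]]]].
have [eps [eps_iso eps_nat]] := GF.
have [e [ez ze]] := eps_iso z.
have [u uE] := equivalence_full FG GF (compm (eps z) (compm v w')).
apply: mem_span; exists (G z), u; split.
  move=> u_iso; apply: nv; apply: (is_iso_cancel_r w'_iso).
  apply: (is_iso_cancel_l (eps_iso z)); rewrite -uE; exact: is_iso_fmap.
exists (cm_map M e n).
rewrite [RHS](_ : _ = cm_map M (fmap F u) (cm_map M e n)) // uE -!cm_comp.
by rewrite (compmA e) ez comp1m /bwd -cm_comp.
Qed.

Definition l2_fwd : l2_mod x rM -> l2_mod y M :=
  @tensor_smap _ _ _ _ (@ga_vN R (aut x)) (@ga_vN R (aut y)) (vN_push aut_iso)
    (splitting rM x) (splitting M y) (quot_smap rely fwd).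

Definition l2_bwd : l2_mod y M -> l2_mod x rM :=
  @tensor_smap _ _ _ _ (@ga_vN R (aut y)) (@ga_vN R (aut x))
    (vN_push (giso_sym aut_iso))
    (splitting M y) (splitting rM x) (quot_smap relx bwd).

Let sfwd := quot_smap_semilinear fwd_semilinear fwd_rel.
Let sbwd := quot_smap_semilinear bwd_semilinear bwd_rel.

Lemma l2_fwd_semilinear : @semilinear (vN R (aut x))^c (vN R (aut y))^c
  (vN_push aut_iso) (l2_mod x rM) (l2_mod y M) l2_fwd.
Proof.
exact: (tensor_smap_semilinear (vN_pushD aut_iso) (vN_pushM aut_iso)
  (vN_push_ga aut_iso) sfwd).
Qed.

Lemma l2_bwdD : {morph l2_bwd : s t / s + t}.
Proof.
exact: (tensor_smapD (vN_pushD (giso_sym aut_iso)) (vN_pushM (giso_sym aut_iso))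
  (vN_push_ga (giso_sym aut_iso)) sbwd).
Qed.

Lemma l2_fwdE m b :
  l2_fwd (l2_gen m b) = l2_gen (cm_map M w m) (vN_push aut_iso b).
Proof.
rewrite /l2_fwd /l2_gen (tensor_smapE (vN_pushD aut_iso) (vN_pushM aut_iso)
  (vN_push_ga aut_iso) sfwd).
by rewrite (quot_smapE _ fwd_semilinear.1 fwd_rel).
Qed.

Lemma l2_bwdE m b :
  l2_bwd (l2_gen m b) = l2_gen (M := rM) (cm_map M w' m)
    (vN_push (giso_sym aut_iso) b).
Proof.
rewrite /l2_bwd /l2_gen (tensor_smapE (vN_pushD (giso_sym aut_iso))
  (vN_pushM (giso_sym aut_iso)) (vN_push_ga (giso_sym aut_iso)) sbwd).
by rewrite (quot_smapE _ bwd_semilinear.1 bwd_rel).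
Qed.

Lemma l2_fwdK : cancel l2_fwd l2_bwd.
Proof.
have fD := l2_fwd_semilinear.1.
apply: (l2_ext (f := l2_bwd \o l2_fwd) (g := id)) => [s t|s t|m b] //=.
  by rewrite fD l2_bwdD.
rewrite l2_fwdE l2_bwdE vN_pushK; congr l2_gen.
by rewrite -cm_comp ww' cm_id.
Qed.

Lemma l2_bwdK : cancel l2_bwd l2_fwd.
Proof.
have fD := l2_fwd_semilinear.1.
apply: (l2_ext (f := l2_fwd \o l2_bwd) (g := id)) => [s t|s t|m b] //=.
  by rewrite l2_bwdD fD.
rewrite l2_bwdE l2_fwdE vN_pushVK; congr l2_gen.
by rewrite -cm_comp w'w cm_id.
Qed.

End Module.

Lemma l2_fwd_map (M N : cmodule R Gam2) (f : cmorphism M N) z :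
  l2_fwd (l2_map x (restrict_mor f) z) = l2_map y f (l2_fwd z).
Proof.
have fD M' : {morph @l2_fwd M' : s t / s + t} := (l2_fwd_semilinear M').1.
have fmD := @l2_mapD _ _ x _ _ (restrict_mor f).
have mfD := @l2_mapD _ _ y _ _ f.
apply: (l2_ext (f := fun z => l2_fwd (l2_map x (restrict_mor f) z))
  (g := fun z => l2_map y f (l2_fwd z))) => [s t|s t|m b].
- exact: etrans (congr1 (@l2_fwd N) (fmD s t)) (fD N _ _).
- exact: etrans (congr1 (l2_map y f) (fD M s t)) (mfD _ _).
rewrite [LHS](congr1 (@l2_fwd N) (l2_mapE (restrict_mor f) m b)).
rewrite [RHS](congr1 (l2_map y f) (l2_fwdE (m : restrict M x) b)).
by rewrite l2_fwdE l2_mapE cmor_nat.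
Qed.

Lemma l2_bwd_map (M N : cmodule R Gam2) (f : cmorphism M N) z :
  l2_bwd (l2_map y f z) = l2_map x (restrict_mor f) (l2_bwd z).
Proof.
apply: (can_inj (@l2_fwdK N)); apply: etrans (l2_bwdK _) _.
exact: esym (etrans (l2_fwd_map f _) (congr1 (l2_map y f) (l2_bwdK z))).
Qed.

Lemma l2_homology_restrict (P : resolution R Gam2) n :
  @semi_iso (vN R (aut x))^c (vN R (aut y))^c (vN_push aut_iso)
    (homology (l2_cpx (restrict_resolution P) x) n) (homology (l2_cpx P y) n).
Proof.
apply: (@homology_semi_iso (vN R (aut x))^c (vN R (aut y))^c (vN_push aut_iso)
  (l2_cpx (restrict_resolution P) x) (l2_cpx P y)
  (fun k => @l2_fwd (P k)) (fun k => @l2_bwd (P k))).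
- by move=> k; apply: l2_fwd_semilinear.
- by move=> k; apply: l2_bwdD.
- by move=> k; apply: l2_fwd_map.
- by move=> k; apply: l2_bwd_map.
- move=> k z _; exists 0; apply: etrans (linear0 _) (esym _).
  exact: etrans (congr1 (fun u => u - z) (l2_fwdK z)) (subrr z).
- move=> k z _; exists 0; apply: etrans (linear0 _) (esym _).
  exact: etrans (congr1 (fun u => u - z) (l2_bwdK z)) (subrr z).
Qed.

End Transport.
End Restriction.

(** * Invariance under equivalence *)

Section L2Invariants.
Variable R : realType.

(** Compare [P1] with the restriction of [P2], which resolves over the same
    category, and then move the latter from [x] to [y]. *)
Lemma vN_dim_homology_equivalence (Gam1 Gam2 : category) (F : functor Gam1 Gam2)
    (P1 : resolution R Gam1) (P2 : resolution R Gam2) (x : Gam1) (y : Gam2) n :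
  is_equivalence F -> isomorphic y (F x) ->
  vN_dim (homology (l2_cpx P1 x) n) = vN_dim (homology (l2_cpx P2 y) n).
Proof.
move=> [G [FG GF]] [w [w' [w'w ww']]].
rewrite (vN_dim_iso (l2_homology_resolution P1 (restrict_resolution FG GF P2) x n)).
exact: vN_dim_semi_iso (l2_homology_restrict FG GF w'w ww' P2 n).
Qed.

Lemma cpx_h2_ext (G H : groupType) (K : chain_complex (vN R G)^c)
    (L : chain_complex (vN R H)^c) :
  (forall n, vN_dim (homology K n) = vN_dim (homology L n)) ->
  cpx_h2 K = cpx_h2 L.
Proof. by move=> KL; apply: eq_eseriesr => n _; apply: KL. Qed.

Lemma cpx_chi2_ext (G H : groupType) (K : chain_complex (vN R G)^c)
    (L : chain_complex (vN R H)^c) :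
  (forall n, vN_dim (homology K n) = vN_dim (homology L n)) ->
  cpx_chi2 K = cpx_chi2 L.
Proof.
move=> KL; rewrite /cpx_chi2; congr (limn (series _)).
by apply/funext => n; rewrite KL.
Qed.

Lemma type_L2_equivalence (Gam1 Gam2 : category) (F : functor Gam1 Gam2) :
  is_equivalence F -> type_L2 R Gam2 -> type_L2 R Gam1.
Proof.
move=> HF [P Pfin]; have [G [FG GF]] := HF.
exists (restrict_resolution FG GF P); apply: le_lt_trans Pfin.
rewrite le_eqVlt; apply/orP; left; apply/eqP.
rewrite /h2_total (reindex_esum setT setT (iso_map F)); last exact: iso_map_bij.
apply: eq_esum => X _; apply: cpx_h2_ext => n.
apply: vN_dim_homology_equivalence HF _.
by apply/iso_classP; rewrite iso_reprK.
Qed.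

End L2Invariants.

Theorem lemma5p15 (R : realType) :
  (forall Gam1 Gam2 : category, equivalent Gam1 Gam2 ->
    ((directly_finite Gam1 /\ type_L2 R Gam1) <->
     (directly_finite Gam2 /\ type_L2 R Gam2)))
  /\
  (forall (Gam1 Gam2 : category) (F : functor Gam1 Gam2)
      (HF : is_equivalence F)
      (df1 : directly_finite Gam1) (L1 : type_L2 R Gam1)
      (df2 : directly_finite Gam2) (L2 : type_L2 R Gam2),
    [/\ bijective (@U1_map R Gam1 Gam2 F HF),
        U1_map HF (chi2_f L1) = chi2_f L2 &
        chi2 L1 = chi2 L2]).
Proof.
split=> [Gam1 Gam2 E|Gam1 Gam2 F HF df1 L1 df2 L2].
  have [F HF] := E; have [G HG] := equivalence_sym E.
  split=> -[df L].
    by split; [exact: directly_finite_equivalence HG df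
              |exact: type_L2_equivalence HG L].
  by split; [exact: directly_finite_equivalence HF df
            |exact: type_L2_equivalence HF L].
have U1_eq (Gam : category) (r s : U1 R Gam) : U1_fun r =1 U1_fun s -> r = s.
  case: r s => [r rS] [s sS] /= /funext rs; subst s.
  by congr MkU1; apply: Prop_irrelevance.
have chiE : U1_fun (chi2_f L1) =1 U1_fun (chi2_f L2) \o iso_map F.
  move=> X /=; apply: cpx_chi2_ext => n.
  apply: vN_dim_homology_equivalence HF _.
  by apply/iso_classP; rewrite iso_reprK.
split.
(* The inverse is precomposition with the bijection of isomorphism classes. *)
- have back_summable (r : U1 R Gam2) :
      esum.summable [set: iso_classes Gam1] (EFin \o (U1_fun r \o iso_map F)).
    rewrite /esum.summable.
    rewrite -(reindex_esum setT setT (iso_map F) (fun Y => `|(U1_fun r Y)%:E|%E)).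
      exact: U1_summable.
    exact: iso_map_bij.
  exists (fun r => MkU1 (back_summable r)) => r; apply: U1_eq => X /=.
    by rewrite iso_map_invK.
  by rewrite iso_mapK.
- apply: U1_eq => Y.
  rewrite -[LHS]/(U1_fun (chi2_f L1) (iso_map_inv HF Y)).
  apply: etrans (chiE (iso_map_inv HF Y)) _; rewrite /comp.
  by rewrite (iso_mapK HF Y).
rewrite /chi2 (funext chiE).
exact: (reindex_sum (U1_fun (chi2_f L2)) (iso_map_invK HF) (iso_mapK HF)).
Qed.
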